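(* Let $f\in C^5(S^1,S^1)$ be uniformly expanding with expansion constant $\omega>1$ and degree $N$ satisfying $N\left(\frac{\max|f''|}{\omega^3}+\frac{1}{\omega^2}\right)<1$, let $h\in C^5(S^1\times S^1,\mathbb{R})$, and let $\rho(t)$ be the unique fixed probability density of the self-consistent transfer operator $\mathcal L_t$ for small $|t|$. Then $$\partial_t\rho|_{t=0}=-(1-P)^{-1}P(\rho(0)A_{\rho(0)})',$$ where $\partial_t$ is understood as $\partial_t:C^1([-\epsilon_3,\epsilon_3],C^1(S^1,\mathbb{R}))\to C^0([-\epsilon_3,\epsilon_3],C^1(S^1,\mathbb{R}))$. More generally, with $\epsilon_2>0$ as in the context, there is $\epsilon_3>0$, $\epsilon_3\le\epsilon_2$, such that for any $\hat t\in(-\epsilon_3,\epsilon_3)$ $$\partial_t\rho|_{t=\hat t}=-(1-P_{\hat t}+\hat tP\mathcal K_{\hat t})^{-1}P(\mathcal K_{\hat t}(\rho(\hat t))),$$ where $P_{\hat t}=PQ_{\hat t,\rho(\hat t)}$ and $$\mathcal K_t(g)=\left(\left(\frac{\rho(t)}{\Phi_{t,\rho(t)}'}A_g\right)\circ\Phi_{t,\rho(t)}^{-1}\right)',\qquad g\in C^1(S^1,\mathbb{R}).$$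
   Context: $S^1$ is the unit circle, represented as $[0,1]$ with $0$ and $1$ identified, with Lebesgue (Haar) measure; all integrals are with respect to it. $\mathbb{R}^+$ is the set of positive reals, $\mathbb R_0^+=\mathbb R^+\cup\{0\}$. A prime denotes the derivative in the circle variable $x$, and $1$ in the operator expressions denotes the identity operator. Uncoupled dynamics: $f:S^1\to S^1$ is uniformly expanding, i.e. there is $\omega>1$ with $|f'(x)|>\omega$ for all $x\in S^1$; $f$ is an $N$-fold covering map. Its transfer operator is $P\varphi(x)=\sum_{y\in f^{-1}(x)}\frac{\varphi(y)}{|f'(y)|}$. Coupling: $A_g(x)=\int_{S^1}h(x,y)g(y)\,dy$ for integrable $g$. For $t\in\mathbb{R}$ with $|t|$ small and $\psi\in L^1(S^1,\mathbb{R}_0^+)$ with $\int\psi=1$, $\Phi_{t,\psi}:S^1\to S^1$, $\Phi_{t,\psi}(x)=x+tA_\psi(x)$ (mod 1). Only $|t|$ small enough that every $\Phi_{t,\psi}$ is a diffeomorphism with $\Phi_{t,\psi}'>0$ are considered. Its transfer operator is $Q_{t,\psi}\varphi=\frac{\varphi}{\Phi_{t,\psi}'}\circ\Phi_{t,\psi}^{-1}$. Self-consistent transfer operator: for a probability density $\psi$, $Q_t(\psi):=Q_{t,\psi}\psi$ and $\mathcal L_t(\psi):=P(Q_t(\psi))$ (a nonlinear map). For $|t|\le\epsilon_0$ ($\epsilon_0$ small), $\rho(t)\in\mathrm{Lip}(S^1,\mathbb R^+)$ is the unique fixed non-negative probability density of $\mathcal L_t$. The number $\epsilon_2\in(0,\epsilon_0]$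 is such that, for suitable constants $C_1,\dots,C_4,K_1,K_2>0$, the set of curves $\gamma:[-\epsilon_2,\epsilon_2]\to\mathcal C$ with $(t,x)\mapsto\gamma(t)(x)$ of class $C^2$, $\sup_t\|\frac{d}{dt}\gamma(t)\|_{C^3}<K_1$ and $\sup_t\|\frac{d^2}{dt^2}\gamma(t)\|_{C^2}<K_2$ is mapped into itself by $\gamma\mapsto(t\mapsto\mathcal L_t(\gamma(t)))$, where $\mathcal C=\{\varphi\in C^4(S^1,\mathbb{R}^+):\int\varphi=1,\ \|\varphi^{(i)}\|_{C^0}<C_i,\ i=1,\dots,4\}$ is invariant under $\mathcal L_t$ for $|t|\le\epsilon_2$. For this $\epsilon_2$ one has $\rho(t)\in C^3(S^1,\mathbb R)$ for $|t|\le\epsilon_2$ and $t\mapsto\rho(t)$ belongs to $C^1([-\epsilon_2,\epsilon_2],C^1(S^1,\mathbb{R}))$. *)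

(* Defs.v *)
From HB Require Import structures.
From mathcomp Require Import all_boot all_order all_algebra.
From mathcomp Require Import all_classical all_reals all_analysis.

Set Implicit Arguments.
Unset Strict Implicit.
Unset Printing Implicit Defensive.

Import Order.TTheory GRing.Theory Num.Theory.
Import numFieldNormedType.Exports.

Local Open Scope classical_set_scope.
Local Open Scope ring_scope.

(* The circle is R/Z.  A function on the circle is a 1-periodic function on
   the line, a function on the torus is 1-periodic in each variable, and a map
   of the circle is given by a lift F : R -> R with F (x + 1) = F x + d for an
   integer d.  Integrals over the circle are Lebesgue integrals over [0, 1]. *)

Section Spaces.
Variable R : realType.
Implicit Types (k : nat) (g : R -> R) (D : set R) (G : R -> R -> R).

Definition Ck k g : Prop :=
  (forall i, (i < k)%N -> forall x, derivable (derive1n i g) x 1) /\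
  (forall i, (i <= k)%N -> continuous (derive1n i g)).

Definition CkS1 k g : Prop := periodic g 1 /\ Ck k g.

(* Derivative at t of a function of which only the values on D count: one-sided
   when t is an endpoint of the interval D. *)
Definition deriv_within D (u : R -> R) (t l : R) : Prop :=
  (u s - u t) / (s - t) @[s --> within D t^'] --> l.

(* Class C^k on D x R, by recursion on the partial derivatives. *)
Fixpoint Ck2 D k G : Prop :=
  {within D `*` [set: R], continuous (fun p : R * R => G p.1 p.2)} /\
  if k is k'.+1 then
    exists Gt Gx : R -> R -> R,
      [/\ forall t x, D t -> deriv_within D (G ^~ x) t (Gt t x),
          forall t x, D t -> is_derive x (1 : R) (G t) (Gx t x),
          Ck2 D k' Gt & Ck2 D k' Gx]
  else True.

Definition CkT2 k G : Prop :=
  [/\ forall y, periodic (G ^~ y) 1, forall x, periodic (G x) 1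
    & Ck2 setT k G].

(* The norms are extended-real valued, so that a bound on a norm implies that
   the function is bounded. *)
Definition C0norm g : \bar R := ereal_sup [set (`|g x|)%:E | x in [set: R]].

Definition Cknorm k g : \bar R := (\sum_(i < k.+1) C0norm (derive1n i g))%E.

Definition C1_mean0 : set (R -> R) :=
  [set g | CkS1 1 g /\ \int[lebesgue_measure]_(x in `[0, 1]) g x = 0].

(* Derivative at t, in the normed space C^1(S^1), of a curve defined on
   [-e, e]. *)
Definition C1_deriv (e : R) (rho : R -> R -> R) (t : R) (g : R -> R) : Prop :=
  CkS1 1 g /\
  Cknorm 1 (fun x => (rho s x - rho t x) / (s - t) - g x)
    @[s --> within `[- e, e] t^'] --> 0%E.

(* rho belongs to C^1([-e, e], C^1(S^1)). *)
Definition C1_curve (e : R) (rho : R -> R -> R) : Prop :=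
  (forall t, t \in `[- e, e] -> CkS1 1 (rho t)) /\
  exists drho : R -> R -> R,
    forall t, t \in `[- e, e] ->
      C1_deriv e rho t (drho t) /\
      Cknorm 1 (drho s \- drho t) @[s --> within `[- e, e] (nbhs t)] --> 0%E.

(* The inverse of T : X -> X; it is meaningful when set_bij X X T holds.  When
   X is a Banach space and T is linear and bounded, the inverse is then bounded
   by the open mapping theorem. *)
Definition inv_on (X : set (R -> R)) (T : (R -> R) -> R -> R) :
  (R -> R) -> R -> R := 'pinv_(fun=> cst 0) X T.

Definition density (psi : R -> R) : Prop :=
  [/\ periodic psi 1, measurable_fun [set: R] psi, forall x, 0 <= psi x,
      lebesgue_measure.-integrable `[0, 1] (EFin \o psi)
    & \int[lebesgue_measure]_(x in `[0, 1]) psi x = 1].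

(* The degree d is negative when the map reverses the orientation. *)
Definition covering_lift (N : nat) (F : R -> R) : Prop :=
  exists2 d : int, `|d|%N = N & forall x, F (x + 1) = F x + d%:~R.

(* An orientation preserving diffeomorphism of the circle, given by a lift. *)
Definition circle_diffeo (Phi : R -> R) : Prop :=
  [/\ forall x, Phi (x + 1) = Phi x + 1, bijective Phi, Ck 1 Phi
    & forall x, 0 < derive1 Phi x].

End Spaces.

Section Operators.
Variables (R : realType) (F : R -> R) (h : R -> R -> R).
Implicit Types (t : R) (psi phi g r : R -> R).

(* The transfer operator of f.  The points y of the circle with f(y) = x are
   represented in [0, 1[. *)
Definition transfer phi (x : R) : R :=
  \sum_(y \in [set y | 0 <= y < 1 /\ exists k : int, F y = x + k%:~R])
    (phi y / `|derive1 F y|).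

Definition A g (x : R) : R :=
  \int[lebesgue_measure]_(y in `[0, 1]) (h x y * g y).

Definition Phi t psi (x : R) : R := x + t * A psi x.

Definition Phi_inv t psi : R -> R := 'pinv_(fun=> 0) [set: R] (Phi t psi).

Definition Q t psi phi : R -> R :=
  (fun x => phi x / derive1 (Phi t psi) x) \o Phi_inv t psi.

Definition L t psi : R -> R := transfer (Q t psi psi).

(* P_t and K_t of the text are Pt t (rho t) and K t (rho t). *)
Definition Pt t r phi : R -> R := transfer (Q t r phi).

Definition K t r g : R -> R :=
  derive1 ((fun x => r x / derive1 (Phi t r) x * A g x) \o Phi_inv t r).

(* C i bounds the derivative of order i; only C 1, ..., C 4 are used. *)
Definition densC (C : nat -> R) : set (R -> R) :=
  [set phi | [/\ CkS1 4 phi, forall x, 0 < phi x,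
      \int[lebesgue_measure]_(x in `[0, 1]) phi x = 1
    & forall i, (1 <= i <= 4)%N -> (C0norm (derive1n i phi) < (C i)%:E)%E]].

Definition curve_set (C : nat -> R) (K1 K2 e : R) : set (R -> R -> R) :=
  [set gam | [/\ forall t, t \in `[- e, e] -> densC C (gam t),
      Ck2 `[- e, e] 2 gam
    & exists dgam ddgam : R -> R -> R,
      [/\ forall t, t \in `[- e, e] ->
            CkS1 3 (dgam t) /\ CkS1 2 (ddgam t),
          forall t x, t \in `[- e, e] ->
            deriv_within `[- e, e] (gam ^~ x) t (dgam t x) /\
            deriv_within `[- e, e] (dgam ^~ x) t (ddgam t x),
          (ereal_sup [set Cknorm 3 (dgam t) | t in `[(- e)%R, e]] < K1%:E)%E
        & (ereal_sup [set Cknorm 2 (ddgam t) | t in `[(- e)%R, e]] < K2%:E)%E]]].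

Definition invariant_curves (e : R) : Prop :=
  exists (C : nat -> R) (K1 K2 : R),
    [/\ forall i, (1 <= i <= 4)%N -> 0 < C i, 0 < K1, 0 < K2,
        forall t, t \in `[- e, e] ->
          forall phi, densC C phi -> densC C (L t phi)
      & forall gam, curve_set C K1 K2 e gam ->
          curve_set C K1 K2 e (fun t => L t (gam t))].

(* r is positive and Lipschitz, and it is the only fixed point of L t among the
   non-negative probability densities in L^1(S^1). *)
Definition unique_fixed_density t r : Prop :=
  [/\ density r, forall x, 0 < r x, exists k : R, k.-lipschitz r, L t r = r
    & forall psi, density psi ->
        {ae lebesgue_measure, forall x, L t psi x = psi x} ->
        {ae lebesgue_measure, forall x, psi x = r x}].

End Operators.

(* Main.v *)
(* A mean-zero function g on the circle satisfies |g| <= |g'| in the sup norm, so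
   |(P g)'| <= N (max |F''| / omega^3 + 1 / omega^2) |g'|: by the hypothesis on
   the degree, P contracts the mean-zero C^1 functions.  For small t the map
   S g = P (Q_t g - t K_t g) is a perturbation of P, hence still a contraction,
   and 1 - S = 1 - P_t + t P K_t is bijective.  The smallness is uniform only if
   the C^2 norm of rho t is bounded uniformly in t; this follows from
   rho t = P (Q_t (rho t)) by Lasota-Yorke inequalities for the first two
   derivatives.  Differentiating this fixed point equation pointwise in t gives
   v = P (Q_t v - K_t (rho t + t v)) for v the derivative of rho at t, that is,
   (1 - S) v = - P (K_t (rho t)). *)
Require Import Defs.
From HB Require Import structures.
From mathcomp Require Import all_boot all_order all_algebra.
From mathcomp Require Import all_classical all_reals all_analysis.
From mathcomp Require Import ring lra zify.

Set Implicit Arguments.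
Unset Strict Implicit.
Unset Printing Implicit Defensive.

Import Order.TTheory GRing.Theory Num.Theory.
Import numFieldNormedType.Exports.

Local Open Scope classical_set_scope.
Local Open Scope ring_scope.

(** * Calculus on the line *)

Section Calculus.
Variable R : realType.
Implicit Types (f g u v : R -> R) (x y c : R).

(** The term [t P K_t] is due to the coupling depending on the density: [Phi_t] is
    [x + A (t rho t) x], so its velocity in [t] is [A] of [g = rho t + t v], and linearity of [K_t]
    in [g] moves the part [t v] to the left side. The derivative [v] exists by the assumption on the
    curve [rho]; bijectivity of the linear operator on mean-zero functions then identifies it. The
    obstacle is that [K_t g] is itself a derivative, so its C^1 size involves the second derivative
    of [rho t]. The function [A_g], however, takes its smoothness from [h]: the sup of [|g|], hence
    that of [|g'|], controls [K_t g], and [t K_t] is small for the contraction norm. [P] and [Q_t]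
    are treated together. A lift is invertible on the line, and its transfer operator is a sum of
    integer translates of one function, [phi o y] times [y'] up to sign, with [y] the inverse; every
    estimate reduces to bounds on three derivatives of [y]. As [P] does not move with [t],
    differentiation in [t] only concerns [Q_t], evaluated along the moving preimage of a fixed
    point. *)

Definition has_deriv f f' : Prop := forall x, is_derive x (1 : R) f (f' x).

Lemma near_dist_le x (e : R) : 0 < e -> \forall y \near x, `|y - x| <= e.
Proof. by move=> e0; exists e => //= y /ltW; rewrite distrC. Qed.

Lemma norm_mul_le x y (a b : R) : `|x| <= a -> `|y| <= b -> `|x * y| <= a * b.
Proof. by move=> xa yb; rewrite normrM ler_pM. Qed.

Lemma continuous_cst c : continuous (fun _ : R => c).
Proof. by move=> x; exact: cvg_cst. Qed.

Lemma continuous_add f g : continuous f -> continuous g ->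
  continuous (fun x => f x + g x).
Proof. by move=> fc gc x; apply: cvgD; [exact: fc|exact: gc]. Qed.

Lemma continuous_opp f : continuous f -> continuous (fun x => - f x).
Proof. by move=> fc x; apply: cvgN; exact: fc. Qed.

Lemma continuous_mul f g : continuous f -> continuous g ->
  continuous (fun x => f x * g x).
Proof. by move=> fc gc x; apply: cvgM; [exact: fc|exact: gc]. Qed.

Lemma continuous_scale c f : continuous f -> continuous (fun x => c * f x).
Proof. by move=> fc; apply: continuous_mul => //; exact: continuous_cst. Qed.

Lemma continuous_exp f n : continuous f -> continuous (fun x => f x ^+ n).
Proof.
move=> fc; elim: n => [|n IH]; first exact: continuous_cst.
by under eq_fun do rewrite exprS; exact: continuous_mul.
Qed.

Lemma continuous_compose f g : continuous f -> continuous g ->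
  continuous (fun x => f (g x)).
Proof. by move=> fc gc x; apply: continuous_comp; [exact: gc|exact: fc]. Qed.

(** Division-free differentiability: estimates uniform in a further variable can be fed into it
    point by point. *)
Lemma is_derive_epsP f x (l : R) : is_derive x (1 : R) f l <->
  forall e, 0 < e -> \forall y \near x, `|f y - f x - l * (y - x)| <= e * `|y - x|.
Proof.
rewrite is_derive1_caratheodory; split=> [[g [fE gc gx]] e e0|H].
  have /cvgrPdist_le/(_ _ e0) := gc; apply: filterS => y gy.
  by rewrite fE -mulrBl normrM -gx distrC; apply: ler_wpM2r.
pose g y := if y == x then l else (f y - f x) / (y - x).
exists g; split; last by rewrite /g eqxx.
- move=> z; rewrite /g; case: eqVneq => [->|]; first by rewrite !subrr mulr0.
  by rewrite -subr_eq0 => /divfK ->.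
- apply/cvgrPdist_le => e e0; apply: filterS (H e e0) => y; rewrite /g eqxx.
  case: eqVneq => [_ _|yx]; first by rewrite subrr normr0 ltW.
  have yx0 : y - x != 0 by rewrite subr_eq0.
  have -> : l - (f y - f x) / (y - x) = - ((f y - f x - l * (y - x)) / (y - x)).
    by field.
  by rewrite normrN normrM normfV ler_pdivrMr ?normr_gt0.
Qed.

Lemma has_derivE f f' : has_deriv f f' -> derive1 f = f'.
Proof. by move=> fD; apply/funext => x; rewrite derive1E; case: (fD x). Qed.

Lemma derivable_has_deriv f :
  (forall x, derivable f x 1) -> has_deriv f (derive1 f).
Proof. by move=> fD x; rewrite derive1E; exact/derivableP. Qed.

Lemma is_derive_continuous f x (l : R) :
  is_derive x (1 : R) f l -> {for x, continuous f}.
Proof.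
by move=> [fD _]; exact/differentiable_continuous/derivable1_diffP.
Qed.

Lemma has_deriv_continuous f f' : has_deriv f f' -> continuous f.
Proof. by move=> fD x; exact: is_derive_continuous (fD x). Qed.

Lemma has_deriv_ext f g f' g' : f =1 g -> f' =1 g' ->
  has_deriv f f' -> has_deriv g g'.
Proof. by move=> /funext<- /funext<-. Qed.

Lemma has_deriv_cst (c : R) : has_deriv (fun=> c) (fun=> 0).
Proof. by move=> x; exact: is_derive_cst. Qed.

Lemma has_deriv_id : has_deriv (fun x => x) (fun=> 1).
Proof. by move=> x; exact: is_derive_id. Qed.

Lemma has_derivD f g f' g' : has_deriv f f' -> has_deriv g g' ->
  has_deriv (fun x => f x + g x) (fun x => f' x + g' x).
Proof. by move=> fD gD x; exact: is_deriveD. Qed.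

Lemma has_derivB f g f' g' : has_deriv f f' -> has_deriv g g' ->
  has_deriv (fun x => f x - g x) (fun x => f' x - g' x).
Proof. by move=> fD gD x; exact: is_deriveB. Qed.

Lemma is_derive_mul f g x (df dg : R) :
  is_derive x (1 : R) f df -> is_derive x (1 : R) g dg ->
  is_derive x (1 : R) (fun y => f y * g y) (df * g x + f x * dg).
Proof.
move=> fD gD; apply: is_derive_eq; rewrite addrC /GRing.scale/=.
by rewrite [g x * _]mulrC.
Qed.

Lemma has_derivM f g f' g' : has_deriv f f' -> has_deriv g g' ->
  has_deriv (fun x => f x * g x) (fun x => f' x * g x + f x * g' x).
Proof. by move=> fD gD x; exact: is_derive_mul. Qed.

Lemma has_derivZ c f f' : has_deriv f f' ->
  has_deriv (fun x => c * f x) (fun x => c * f' x).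
Proof.
move=> fD; have := has_derivM (has_deriv_cst c) fD.
by apply: has_deriv_ext => // x; rewrite mul0r add0r.
Qed.

Lemma has_deriv_comp f g f' g' : has_deriv f f' -> has_deriv g g' ->
  has_deriv (fun x => f (g x)) (fun x => f' (g x) * g' x).
Proof. by move=> fD gD x; exact: is_derive1_comp. Qed.

Lemma has_deriv_shift c f f' : has_deriv f f' ->
  has_deriv (fun x => f (x + c)) (fun x => f' (x + c)).
Proof.
move=> fD; have sD : has_deriv (fun x => x + c) (fun=> 1).
  have := has_derivD has_deriv_id (has_deriv_cst c).
  by apply: has_deriv_ext => // x; rewrite addr0.
have := has_deriv_comp fD sD.
by apply: has_deriv_ext => // x; rewrite mulr1.
Qed.

Lemma has_deriv_sum n (f f' : 'I_n -> R -> R) :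
  (forall i, has_deriv (f i) (f' i)) ->
  has_deriv (fun x => \sum_(i < n) f i x) (fun x => \sum_(i < n) f' i x).
Proof.
move=> fD x; rewrite -fct_sumE.
by apply: is_derive_sum => i; exact: fD.
Qed.

Lemma is_derive_inv f x (l : R) : f x != 0 -> is_derive x (1 : R) f l ->
  is_derive x (1 : R) (fun y => (f y)^-1) (- (l / f x ^+ 2)).
Proof.
move=> fx0 fD; apply: (is_derive_eq (is_deriveV fx0 fD)).
by rewrite /GRing.scale/= mulNr mulrC.
Qed.

Lemma mean_value f f' x y : has_deriv f f' ->
  exists2 z, `|z - x| <= `|y - x| & f y - f x = f' z * (y - x).
Proof.
move=> fD; have fc := has_deriv_continuous fD.
have H a b : a <= b -> exists2 z, a <= z <= b & f b - f a = f' z * (b - a).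
  move=> ab; have [|z zab zE] := MVT_segment ab (fun z _ => fD z).
    exact: continuous_subspaceT.
  by exists z => //; move: zab; rewrite in_itv.
have [xy|/ltW yx] := leP x y.
  have [z /andP[xz zy] zE] := H _ _ xy; exists z => //.
  by rewrite !ger0_norm ?subr_ge0// lerD2r.
have [z /andP[yz zx] zE] := H _ _ yx; exists z.
  by rewrite !ler0_norm ?subr_le0// !opprB lerD2l lerN2.
by rewrite -opprB zE -mulrN opprB.
Qed.

Lemma lipschitz_of_deriv f f' c : has_deriv f f' ->
  (forall x, `|f' x| <= c) -> forall x y, `|f y - f x| <= c * `|y - x|.
Proof.
by move=> fD f'c x y; have [z _ ->] := mean_value x y fD; rewrite normrM ler_wpM2r.
Qed.

(** Two uses of the mean value theorem give the constant [c]; the sharper [c / 2] would bring no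
    gain later. *)
Lemma taylor1_bound f f1 f2 c : has_deriv f f1 -> has_deriv f1 f2 ->
  (forall x, `|f2 x| <= c) ->
  forall x y, `|f y - f x - f1 x * (y - x)| <= c * `|y - x| ^+ 2.
Proof.
move=> fD f1D f2c x y; have [z zx ->] := mean_value x y fD.
rewrite -mulrBl normrM expr2 mulrA ler_wpM2r//.
apply: le_trans (lipschitz_of_deriv f1D f2c x z) _.
by rewrite ler_wpM2l// (le_trans _ (f2c x)).
Qed.

Lemma deriv0_cst f f' : has_deriv f f' -> (forall x, f' x = 0) ->
  forall x y, f x = f y.
Proof.
by move=> fD f'0 x y; apply: is_derive_0_is_cst => z; rewrite -(f'0 z).
Qed.

Lemma periodic_int f : periodic f 1 -> forall (k : int) x, f (x + k%:~R) = f x.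
Proof.
move=> fp [n|n] x; first by rewrite -pmulrn; exact: periodicn.
by rewrite NegzE mulrNz -{2}(subrK (n.+1%:~R) x) -pmulrn periodicn.
Qed.

Lemma periodic_reduce f : periodic f 1 ->
  forall x, exists2 y, 0 <= y < 1 & f x = f y.
Proof.
move=> fp x; exists (x - (Num.floor x)%:~R).
  have := floorD1_gt x; rewrite intrD => fx.
  by rewrite subr_ge0 floor_le ltrBlDl.
by rewrite -mulrNz periodic_int.
Qed.

Lemma has_deriv_periodic f f' : periodic f 1 -> has_deriv f f' -> periodic f' 1.
Proof.
move=> fp fD x; have /has_derivE <- := fD.
have {2}-> : f = (fun x => f (x + 1)) by apply/funext => y; rewrite fp.
by rewrite (has_derivE (has_deriv_shift 1 fD)) (has_derivE fD).
Qed.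

Lemma continuous_within_itv f (a b : R) :
  continuous f -> {within `[a, b], continuous f}.
Proof. exact: continuous_subspaceT. Qed.

Lemma continuous_periodic_bounded f : periodic f 1 -> continuous f ->
  exists c, forall x, `|f x| <= c.
Proof.
move=> fp fc.
have [a _ aP] := EVT_max ler01 (continuous_within_itv (a := 0) (b := 1) fc).
have [b _ bP] := EVT_min ler01 (continuous_within_itv (a := 0) (b := 1) fc).
exists (Num.max (f a) (- f b)) => x.
have [y /andP[y0 y1] ->] := periodic_reduce fp x.
have yI : y \in `[0, 1] by rewrite in_itv/= y0 ltW.
by rewrite ler_norml lerNl le_max lerN2 bP ?orbT//= le_max aP.
Qed.

(** The best [c] is the sup of [|f|], which satisfies [sup <= k * sup + b]; as it is finite,
    [k * sup] can be subtracted. This turns a Lasota-Yorke inequality at a fixed point into an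
    absolute bound, and with [b = 0] gives uniqueness. *)
Lemma self_improving_bound f (k b : R) : k < 1 ->
  (exists c, forall x, `|f x| <= c) ->
  (forall c, (forall x, `|f x| <= c) -> forall x, `|f x| <= k * c + b) ->
  forall x, `|f x| <= b / (1 - k).
Proof.
move=> k1 [c0 fc0] H.
set S := [set `|f x| | x in setT].
have Sub : has_sup S.
  by split; [exists `|f 0|, 0 | exists c0 => _ [x _ <-]].
have SP x : `|f x| <= sup S by apply: ub_le_sup; [case: Sub|exists x].
have : sup S <= k * sup S + b.
  by apply: ge_sup => [|_ [x _ <-]]; [case: Sub|exact: H].
move=> Sle x; apply: (le_trans (SP x)).
by rewrite ler_pdivlMr ?subr_gt0//; nra.
Qed.

End Calculus.

(** * Means over the circle *)

Section Integrals.
Variable R : realType.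
Implicit Types (f g r u v w : R -> R) (x y c : R).
Notation mu := (@lebesgue_measure R).

Lemma continuous_integrable f (a b : R) :
  continuous f -> mu.-integrable `[a, b] (EFin \o f).
Proof.
move=> fc; apply: continuous_compact_integrable; first exact: segment_compact.
exact: continuous_within_itv.
Qed.

Definition circle_mean f : R := \int[mu]_(x in `[0, 1]) f x.

Lemma circle_mean_cst c : circle_mean (fun=> c) = c.
Proof.
rewrite /circle_mean Rintegral_cst//= lebesgue_measure_itv/= lte01.
by rewrite oppr0 addr0 mulr1.
Qed.

Lemma circle_meanD f g : continuous f -> continuous g ->
  circle_mean (fun x => f x + g x) = circle_mean f + circle_mean g.
Proof. by move=> fc gc; apply: RintegralD => //; exact: continuous_integrable. Qed.

Lemma circle_meanB f g : continuous f -> continuous g ->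
  circle_mean (fun x => f x - g x) = circle_mean f - circle_mean g.
Proof. by move=> fc gc; apply: RintegralB => //; exact: continuous_integrable. Qed.

Lemma circle_meanZ c f : continuous f ->
  circle_mean (fun x => c * f x) = c * circle_mean f.
Proof. by move=> fc; apply: RintegralZl => //; exact: continuous_integrable. Qed.

(** The weight enters only through its mass, so for a density [r] the bound does not depend on the
    size of [r]. *)
Lemma circle_mean_weighted f r c : continuous f -> continuous r ->
  (forall x, 0 <= r x) -> (forall x, `|f x| <= c) ->
  `|circle_mean (fun x => f x * r x)| <= c * circle_mean r.
Proof.
move=> fc rc r0 fb; have frc := continuous_mul fc rc.
have frn : continuous (fun x => `|f x * r x|).
  by move=> x; apply: cvg_norm; exact: frc.
rewrite -circle_meanZ// /circle_mean.
apply: le_trans; first by apply: le_normr_Rintegral => //; exact: continuous_integrable.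
apply: le_Rintegral => //.
- exact: continuous_integrable.
- by apply: continuous_integrable; apply: continuous_mul => // x; exact: cvg_cst.
- by move=> x _; rewrite normrM (ger0_norm (r0 x)) ler_wpM2r.
Qed.

Lemma circle_mean_bounded f c : continuous f -> (forall x, `|f x| <= c) ->
  `|circle_mean f| <= c.
Proof.
move=> fc fb.
rewrite -[leRHS]mulr1 -[X in _ * X]circle_mean_cst.
rewrite [X in circle_mean X](_ : f = fun x => f x * 1); last first.
  by apply/funext => x; rewrite mulr1.
by apply: circle_mean_weighted => // x; exact: cvg_cst.
Qed.

Lemma circle_mean_deriv w f : has_deriv w f -> continuous f ->
  circle_mean f = w 1 - w 0.
Proof.
move=> wD fc; have wc := has_deriv_continuous wD.
rewrite /circle_mean /Rintegral (@continuous_FTC2 _ f w)//.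
- exact: continuous_within_itv.
- split=> [x _||]; first by case: (wD x).
  + by apply: cvg_at_right_filter; exact: wc.
  + by apply: cvg_at_left_filter; exact: wc.
- by move=> x _; rewrite (has_derivE wD).
Qed.

(* The fundamental theorem of calculus is available only to the right of the
   lower limit of integration, which therefore has to move to the left with x. *)
Lemma has_primitive f : continuous f -> exists w, has_deriv w f.
Proof.
move=> fc.
pose W a x := \int[mu]_(t in `[a, x]) f t.
have WB a b x : a <= b -> b <= x -> W a x = W a b + \int[mu]_(t in `]b, x]) f t.
  move=> ab bx; rewrite -(@Rintegral_itvB _ f (BLeft a) (BRight x) b) ?bnd_simp//.
    by rewrite addrC subrK.
  exact: continuous_integrable.
have WE a b x y : a <= b -> b <= x -> b <= y -> W a x - W a y = W b x - W b y.
  move=> ab bx bY; rewrite (WB a b x)// (WB a b y)// (WB b b x)// (WB b b y)//.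
  by ring.
exists (fun x => W (Num.min x 0 - 1) x - W (Num.min x 0 - 1) 0) => x.
(* A difference of two integrals from the same base point does not depend on that point ([WE]), so
   for [|y - x| <= 1] the moving base point can be frozen at [a], one unit further to the left. *)
set a := Num.min x 0 - 1 - 1.
have xa : a < x - 1.
  by rewrite /a ltrD2r (@le_lt_trans _ _ (x - 1)) ?gtrBl// lerD2r ge_min lexx.
apply: (@near_eq_is_derive _ _ _ (fun y => W a y - W a 0)).
  near=> y.
  have ay : a <= Num.min y 0 - 1.
    rewrite /a lerD2r le_min; apply/andP; split; last first.
      by rewrite lerBlDr (@le_trans _ _ 0)// ge_min lexx orbT.
    apply: (@le_trans _ _ (x - 1)); first by rewrite lerD2r ge_min lexx.
    have : `|y - x| <= 1 by near: y; exact: near_dist_le.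
    by rewrite ler_norml lerBrDl addrC => /andP[].
  apply: WE => //; last by rewrite lerBlDr (@le_trans _ _ 0) ?ge_min ?lexx ?orbT.
  by rewrite lerBlDr (@le_trans _ _ y) ?ge_min ?lexx// lerDl.
have [Wd WE1] : derivable (W a) x 1 /\ derive1 (W a) x = f x.
  apply: (@continuous_FTC1_closed _ f a x (x + 1)) => //; last exact: fc.
  - by rewrite ltrDl.
  - exact: continuous_integrable.
  - by rewrite (lt_trans xa)// gtrBl.
have D : is_derive x (1 : R) (W a) (f x).
  by rewrite -WE1 derive1E; exact/derivableP.
have := is_deriveB D (is_derive_cst (W a 0) x 1).
by rewrite subr0.
Unshelve. all: by end_near. Qed.

(** The increment of a primitive over a period has derivative [f (x + 1) - f x = 0], so it is
    constant, and it equals the mean of [f]. *)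
Lemma periodic_primitive f : periodic f 1 -> continuous f -> circle_mean f = 0 ->
  exists2 w, has_deriv w f & periodic w 1.
Proof.
move=> fp fc f0; have [w wD] := has_primitive fc; exists w => // x.
have D := has_derivB (has_deriv_shift 1 wD) wD.
have E : w (x + 1) - w x = w (0 + 1) - w 0.
  by apply: (deriv0_cst D) => y; rewrite fp subrr.
by apply/eqP; rewrite -subr_eq0 E add0r -(circle_mean_deriv wD fc) f0.
Qed.

Lemma circle_mean_periodic_deriv w f : has_deriv w f -> continuous f ->
  periodic w 1 -> circle_mean f = 0.
Proof.
by move=> wD fc wp; rewrite (circle_mean_deriv wD fc) -[1]add0r wp subrr.
Qed.

(** Two points of the circle have representatives in [0, 1[, at distance at most 1, so [f]
    oscillates by at most [c]; then average over one of the points. *)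
Lemma dist_circle_mean f f' c : periodic f 1 -> has_deriv f f' ->
  (forall x, `|f' x| <= c) -> forall x, `|f x - circle_mean f| <= c.
Proof.
move=> fp fD f'c x; have fc := has_deriv_continuous fD.
have c0 : 0 <= c by rewrite (le_trans _ (f'c 0)).
have dist y z : `|f y - f z| <= c.
  have [y' /andP[y0 y1] ->] := periodic_reduce fp y.
  have [z' /andP[z0 z1] ->] := periodic_reduce fp z.
  apply: (le_trans (lipschitz_of_deriv fD f'c z' y')).
  by rewrite -[leRHS]mulr1 ler_wpM2l// ler_norml; apply/andP; split; lra.
have cc (k : R) : continuous (fun _ : R => k) by move=> ?; exact: cvg_cst.
rewrite -[f x]circle_mean_cst -circle_meanB//.
by apply: circle_mean_bounded => // y; apply: cvgB; [exact: cc|exact: fc].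
Qed.

Lemma mean0_bound f f' c : periodic f 1 -> has_deriv f f' -> circle_mean f = 0 ->
  (forall x, `|f' x| <= c) -> forall x, `|f x| <= c.
Proof.
by move=> fp fD f0 f'c x; rewrite -[f x]subr0 -f0; exact: dist_circle_mean fD _ _.
Qed.

Lemma mean0_deriv0 f f' : periodic f 1 -> has_deriv f f' -> circle_mean f = 0 ->
  (forall x, f' x = 0) -> forall x, f x = 0.
Proof.
move=> fp fD f0 f'0 x; apply/eqP; rewrite -normr_le0.
by apply: (mean0_bound fp fD f0) => y; rewrite f'0 normr0.
Qed.

End Integrals.

(** * Contractions of mean-zero C^1 functions *)

Section Contraction.
Variable R : realType.
Implicit Types (f g u v w : R -> R) (x y c k : R).

Lemma CkS1_1P g : CkS1 1 g <->
  periodic g 1 /\ exists2 g', has_deriv g g' & continuous g'.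
Proof.
split=> [[gp [gD gc]]|[gp [g' gD gc]]]; split => //.
  exists (derive1 g); last exact: (gc 1%N).
  by apply: derivable_has_deriv; exact: (gD 0%N).
split=> [[|//] _ x|[_|[_|//]]]; first by case: (gD x).
  exact: has_deriv_continuous gD.
by rewrite derive1n1 (has_derivE gD).
Qed.

Lemma C1_mean0P g : C1_mean0 g <->
  [/\ periodic g 1, has_deriv g (derive1 g), continuous (derive1 g)
    & circle_mean g = 0].
Proof.
split=> [[/CkS1_1P[gp [g' gD gc]] g0]|[gp gD gc g0]].
  by rewrite (has_derivE gD).
by split => //; apply/CkS1_1P; split=> //; exists (derive1 g).
Qed.

Lemma C1_mean0_intro g g' : periodic g 1 -> has_deriv g g' -> continuous g' ->
  circle_mean g = 0 -> C1_mean0 g.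
Proof. by move=> gp gD gc g0; apply/C1_mean0P; rewrite (has_derivE gD). Qed.

Lemma C1_mean0D f g : C1_mean0 f -> C1_mean0 g -> C1_mean0 (f + g).
Proof.
move=> /C1_mean0P[fp fD fc f0] /C1_mean0P[gp gD gc g0].
apply: (C1_mean0_intro _ (has_derivD fD gD)).
- by move=> x; rewrite /= fp gp.
- by move=> x; apply: cvgD; [exact: fc|exact: gc].
- by rewrite circle_meanD ?f0 ?g0 ?addr0//; exact: has_deriv_continuous.
Qed.

Lemma C1_mean0Z c g : C1_mean0 g -> C1_mean0 (c *: g).
Proof.
move=> /C1_mean0P[gp gD gc g0].
apply: (C1_mean0_intro _ (has_derivZ c gD)).
- by move=> x; rewrite /= gp.
- by move=> x; apply: cvgM; [exact: cvg_cst|exact: gc].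
- by rewrite circle_meanZ ?g0 ?mulr0//; exact: has_deriv_continuous.
Qed.

Lemma C1_mean0B f g : C1_mean0 f -> C1_mean0 g -> C1_mean0 (f - g).
Proof.
by move=> fX gX; rewrite -scaleN1r; apply: C1_mean0D => //; exact: C1_mean0Z.
Qed.

Lemma C1_mean0_bound g c : C1_mean0 g -> (forall x, `|derive1 g x| <= c) ->
  forall x, `|g x| <= c.
Proof. by move=> /C1_mean0P[gp gD _ g0]; exact: mean0_bound gD _. Qed.

Lemma C1_mean0_eq0 g : C1_mean0 g -> (forall x, derive1 g x = 0) -> g = 0.
Proof.
move=> /C1_mean0P[gp gD _ g0] d0; apply/funext => x.
exact: (mean0_deriv0 gp gD g0 d0).
Qed.

Lemma geometric_small c k e : 0 <= k < 1 -> 0 < e -> exists n, c * k ^+ n <= e.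
Proof.
move=> /andP[k0 k1] e0.
have k1' : `|k| < 1 by rewrite ger0_norm.
have /cvgrPdist_le/(_ _ e0)[n _ /(_ n (leqnn n))] := cvg_geometric c k1'.
by rewrite sub0r normrN => /ler_normlW; exists n.
Qed.

(** Nested intervals: with [C = c / (1 - k)], that is [C = c + C * k], the sequence [a n - C k^n]
    increases and [a n + C k^n] decreases. The sup of the former lies below every term of the
    latter. *)
Lemma geometric_cauchy_limit (a : nat -> R) c k : 0 <= k < 1 ->
  (forall n, `|a n.+1 - a n| <= c * k ^+ n) ->
  exists l, forall n, `|l - a n| <= c / (1 - k) * k ^+ n.
Proof.
move=> /andP[k0 k1] ac; pose C := c / (1 - k).
have k1' : 1 - k != 0 by rewrite subr_eq0 eq_sym lt_eqF.
have cE : c = C - C * k by rewrite /C; field.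
have C0 : 0 <= C.
  rewrite divr_ge0 ?subr_ge0 ?(ltW k1)//.
  by have := ac 0%N; rewrite expr0 mulr1; exact: (le_trans (normr_ge0 _)).
have Ck0 n : 0 <= C * k ^+ n by rewrite mulr_ge0// exprn_ge0.
pose b n := a n - C * k ^+ n; pose d n := a n + C * k ^+ n.
have bS n : b n <= b n.+1 /\ d n.+1 <= d n.
  rewrite /b /d !exprS.
  by have := ac n; rewrite cE mulrBl -mulrA ler_norml => /andP[]; split; lra.
have bmono m n : (m <= n)%N -> b m <= b n /\ d n <= d m.
  move=> /subnK<-; elim: (n - m)%N => [//|i [IHb IHd]]; rewrite addSn.
  by have [] := bS (i + m)%N; split; lra.
have bd m n : b m <= d n.
  have [bl _] := bmono _ _ (leq_maxl m n); have [_ dl] := bmono _ _ (leq_maxr m n).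
  have := Ck0 (maxn m n).
  by move: bl dl; rewrite /b /d; lra.
exists (sup (range b)) => n; rewrite ler_distl; apply/andP; split.
- apply: ub_le_sup; last by exists n.
  by exists (d n) => _ [m _ <-].
- apply: ge_sup; first by exists (b 0%N), 0%N.
  by move=> _ [m _ <-]; exact: bd.
Qed.

(** Completeness of C^1 with an explicit rate. The key is [lip]: the Lipschitz bound of [g m - g n]
    does not depend on [m >= n], so it survives the limit in [m] and compares increments of [G] with
    those of [g n]. *)
Lemma C1_geometric_limit (g g' : nat -> R -> R) c k : 0 <= k < 1 ->
  (forall n, has_deriv (g n) (g' n)) -> (forall n, continuous (g' n)) ->
  (forall n x, `|g n.+1 x - g n x| <= c * k ^+ n) ->
  (forall n x, `|g' n.+1 x - g' n x| <= c * k ^+ n) ->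
  exists G G', [/\ has_deriv G G', continuous G',
    forall n x, `|G x - g n x| <= c / (1 - k) * k ^+ n
  & forall n x, `|G' x - g' n x| <= c / (1 - k) * k ^+ n].
Proof.
move=> k01 gD gc gE g'E.
have /choice[G GE] x := geometric_cauchy_limit k01 (fun n => gE n x).
have /choice[G' G'E] x := geometric_cauchy_limit k01 (fun n => g'E n x).
have [k0 k1] := andP k01.
set C := c / (1 - k) in GE G'E *.
have small_ge m e : 0 < e -> exists2 n, (m <= n)%N & C * k ^+ n <= e.
  move=> /(geometric_small (C * k ^+ m) k01)[n]; rewrite -mulrA -exprD.
  by exists (m + n)%N => //; exact: leq_addr.
have lip n x y : `|(G y - g n y) - (G x - g n x)| <= 2 * (C * k ^+ n) * `|y - x|.
  apply/ler_addgt0Pr => e e0.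
  have [|m nm mE] := small_ge n (e / 2); first by rewrite divr_gt0.
  have Cmn : C * k ^+ m <= C * k ^+ n.
    have C0 : 0 <= C.
      by have := GE 0 0%N; rewrite expr0 mulr1; exact: (le_trans (normr_ge0 _)).
    by rewrite ler_wpM2l// ler_wiXn2l// ltW.
  have L := lipschitz_of_deriv (has_derivB (gD m) (gD n)) (c := 2 * (C * k ^+ n)).
  have {L} : `|g m y - g n y - (g m x - g n x)| <= 2 * (C * k ^+ n) * `|y - x|.
    apply: L => z; have := G'E z n; have := G'E z m.
    by rewrite !ler_distl => /andP[? ?] /andP[? ?]; apply/andP; split; lra.
  have := GE x m; have := GE y m.
  rewrite !ler_distl => /andP[? ?] /andP[? ?] /andP[? ?].
  by apply/andP; split; lra.
exists G, G'; split => // x; last first.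
  apply/cvgrPdist_le => e e0.
  have [|n nE] := geometric_small C k01 (e := e / 3); first by rewrite divr_gt0.
  have /cvgrPdist_le/(_ (e / 3)) := gc n x => /(_ (divr_gt0 e0 _)) H.
  apply: filterS (H _) => // y; have := G'E x n; have := G'E y n.
  rewrite !ler_distl => /andP[? ?] /andP[? ?] /andP[? ?].
  by apply/andP; split; lra.
apply/is_derive_epsP => e e0.
(* The comparison with [g n] costs [3 * C * k ^+ n * |y - x|]: two parts from [lip] and one from the
   derivatives. This uses up [e / 2], and the remainder of [g n] the other half. *)
have [|n nE] := geometric_small C k01 (e := e / 6); first by rewrite divr_gt0.
have /is_derive_epsP/(_ (e / 2)) := gD n x => /(_ (divr_gt0 e0 _)) H.
apply: filterS (H _) => // y gy.
have -> : G y - G x - G' x * (y - x) = (G y - g n y - (G x - g n x)) +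
  (g n y - g n x - g' n x * (y - x)) - (G' x - g' n x) * (y - x) by ring.
have h1 := lip n x y.
have h2 : `|(G' x - g' n x) * (y - x)| <= C * k ^+ n * `|y - x|.
  by rewrite normrM ler_wpM2r.
have h3 : C * k ^+ n * `|y - x| <= e / 6 * `|y - x| by rewrite ler_wpM2r.
apply: (le_trans (ler_normB _ _)); apply: (le_trans (lerD (ler_normD _ _) h2)).
lra.
Qed.

(* On mean-zero functions the sup norm of g' is a norm equivalent to the C^1
   norm, so this is the Neumann series of (1 - S)^-1. *)
Lemma C1_mean0_contraction_bij (S : (R -> R) -> R -> R) k : 0 <= k < 1 ->
  (forall g, C1_mean0 g -> C1_mean0 (S g)) ->
  (forall f g, C1_mean0 f -> C1_mean0 g -> S (f - g) = S f - S g) ->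
  (forall g c, C1_mean0 g -> (forall x, `|derive1 g x| <= c) ->
     forall x, `|derive1 (S g) x| <= k * c) ->
  set_bij (@C1_mean0 R) (@C1_mean0 R) (fun g => g - S g).
Proof.
move=> k01 SX SB Sk; have [k0 k1] := andP k01; split.
- by move=> g gX; apply: C1_mean0B => //; exact: SX.
- move=> f g /set_mem fX /set_mem gX E; apply/eqP; rewrite -subr_eq0; apply/eqP.
  have fgX := C1_mean0B fX gX.
  have E' : S (f - g) = f - g.
    have Ef : S f = f - (g - S g) by move: E => /= <-; rewrite subKr.
    by rewrite SB// Ef opprB addrA addrAC addrK.
  apply: C1_mean0_eq0 => // x; apply/eqP; rewrite -normr_le0.
  have [fgp fgD fgc _] := (C1_mean0P _).1 fgX.
  (* The bound 0 is written as [0 / (1 - k)], the conclusion of [self_improving_bound] for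
     [b = 0]. *)
  rewrite -[leRHS](mul0r (1 - k)^-1).
  apply: self_improving_bound => //.
    exact: continuous_periodic_bounded (has_deriv_periodic fgp fgD) fgc.
  by move=> c /(Sk _ _ fgX); rewrite E' addr0.
move=> u uX; pose g n := iter n (fun f => u + S f) u.
have gX n : C1_mean0 (g n) by elim: n => //= n IH; apply: C1_mean0D => //; exact: SX.
have dX n : C1_mean0 (g n.+1 - g n) by exact: C1_mean0B.
have gS n : g n.+1 = u + S (g n) by [].
have dS n : g n.+2 - g n.+1 = S (g n.+1 - g n).
  by rewrite SB// (gS n.+1) [X in _ - X = _](gS n) opprD addrACA subrr add0r.
have gp n := (C1_mean0P _).1 (gX n).
have [c dc] : exists c, forall n x, `|derive1 (g n.+1 - g n) x| <= c * k ^+ n.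
  have [dp dD dC _] := (C1_mean0P _).1 (dX 0%N).
  have [c Hc] := continuous_periodic_bounded (has_deriv_periodic dp dD) dC.
  exists c; elim=> [x|n IH x]; first by rewrite expr0 mulr1.
  by rewrite dS exprS mulrCA; exact: Sk.
have gD n : has_deriv (g n) (derive1 (g n)) by case: (gp n).
have gC n : continuous (derive1 (g n)) by case: (gp n).
have dE n : derive1 (g n.+1 - g n) = derive1 (g n.+1) - derive1 (g n).
  exact: has_derivE (has_derivB (gD n.+1) (gD n)).
have [n x|n x|G [G' [GD GC GE G'E]]] := C1_geometric_limit k01 gD gC (c := c).
- exact: (C1_mean0_bound (dX n) (dc n)).
- by have := dc n x; rewrite dE.
set C := c / (1 - k) in GE G'E.
have GX : C1_mean0 G.
  apply: (C1_mean0_intro _ GD GC).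
    move=> x; apply/eqP; rewrite -subr_eq0 -normr_le0.
    apply/ler_addgt0Pr => e e0; rewrite add0r.
    have [|n nE] := geometric_small C k01 (e := e / 2); first by rewrite divr_gt0.
    have [gpn _ _ _] := gp n; have := GE n x; have := GE n (x + 1).
    rewrite gpn !ler_distl => /andP[? ?] /andP[? ?].
    by apply/andP; split; lra.
  apply/eqP; rewrite -normr_le0; apply/ler_addgt0Pr => e e0; rewrite add0r.
  have [n nE] := geometric_small C k01 e0.
  have [_ _ _ gn0] := gp n.
  rewrite -[circle_mean G]subr0 -gn0 -circle_meanB; last 2 first.
    exact: has_deriv_continuous GD.
    exact: has_deriv_continuous (gD n).
  apply: circle_mean_bounded => [|x]; last exact: le_trans (GE n x) nE.
  exact: has_deriv_continuous (has_derivB GD (gD n)).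
exists G => //.
(* It is enough to show that the residual has zero derivative, since it is mean-zero. Replacing [u]
   by [g n.+1 - S (g n)] splits it into two terms with small derivatives. *)
have EX : C1_mean0 (G - S G - u).
  by apply: C1_mean0B => //; apply: C1_mean0B => //; exact: SX.
apply/eqP; rewrite -subr_eq0; apply/eqP; apply: C1_mean0_eq0 => // x.
apply/eqP; rewrite -normr_le0; apply/ler_addgt0Pr => e e0; rewrite add0r.
have [|n nE] := geometric_small C k01 (e := e / 2); first by rewrite divr_gt0.
have GgX : C1_mean0 (G - g n) by exact: C1_mean0B.
have [_ SD _ _] := (C1_mean0P _).1 (SX _ GgX).
have -> : G - S G - u = (G - g n.+1) - S (G - g n).
  by rewrite SB// gS; apply/funext => z; rewrite !fctE; ring.
have -> : derive1 (G - g n.+1 - S (G - g n)) x =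
    (G' x - derive1 (g n.+1) x) - derive1 (S (G - g n)) x.
  have := has_derivE (has_derivB (has_derivB GD (gD n.+1)) SD).
  by move=> /(congr1 (@^~ x)).
have h1 : `|G' x - derive1 (g n.+1) x| <= e / 2.
  apply: le_trans (G'E n.+1 x) _; apply: le_trans nE.
  rewrite ler_wpM2l ?ler_wiXn2l ?(ltW k1)//.
  by have := GE 0%N 0; rewrite expr0 mulr1; exact: (le_trans (normr_ge0 _)).
have h2 : `|derive1 (S (G - g n)) x| <= e / 2.
  apply: (@le_trans _ _ (k * (C * k ^+ n))).
    apply: Sk => // z; have := has_derivE (has_derivB GD (gD n)).
    by move=> /(congr1 (@^~ z)) ->; exact: G'E.
  apply: le_trans nE; rewrite ler_piMl ?(ltW k1)//.
  exact: le_trans (normr_ge0 _) (GE n 0).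
by apply: (le_trans (ler_normB _ _)); lra.
Qed.

End Contraction.

(** * Inverse branches and transfer operators *)

Section Branches.
Variable R : realType.
Implicit Types (f g u v w phi y : R -> R) (x c k : R).

(* When y is an inverse branch of a map T, y' = 1 / (T' o y) and this is the
   contribution of the branch to the transfer operator of T (up to the sign
   of T'). *)
Definition wcomp y (y1 : R -> R) phi : R -> R := fun x => phi (y x) * y1 x.

Lemma wcomp_deriv1 phi phi1 y y1 y2 : has_deriv phi phi1 ->
  has_deriv y y1 -> has_deriv y1 y2 ->
  has_deriv (wcomp y y1 phi)
            (fun x => phi1 (y x) * y1 x ^+ 2 + phi (y x) * y2 x).
Proof.
move=> D1 yD y1D; have := has_derivM (has_deriv_comp D1 yD) y1D.
by apply: has_deriv_ext => // x; ring.
Qed.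

Lemma wcomp_deriv2 phi phi1 phi2 y y1 y2 y3 :
  has_deriv phi phi1 -> has_deriv phi1 phi2 ->
  has_deriv y y1 -> has_deriv y1 y2 -> has_deriv y2 y3 ->
  has_deriv (fun x => phi1 (y x) * y1 x ^+ 2 + phi (y x) * y2 x)
    (fun x => phi2 (y x) * y1 x ^+ 3 + 3 * phi1 (y x) * y1 x * y2 x
              + phi (y x) * y3 x).
Proof.
move=> D1 D2 yD y1D y2D.
have H1 := has_derivM (has_deriv_comp D2 yD) (has_derivM y1D y1D).
have H2 := has_derivM (has_deriv_comp D1 yD) y2D.
by have := has_derivD H1 H2; apply: has_deriv_ext => x; ring.
Qed.

Lemma inverse_deriv f f1 g : has_deriv f f1 -> (forall x, f1 x != 0) ->
  cancel f g -> cancel g f -> has_deriv g (fun x => (f1 (g x))^-1).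
Proof.
move=> fD f1N0 fK gK x; rewrite -{1}[x]gK.
apply: (is_derive_inverse _ _ (fD (g x)) (f1N0 _)).
- exact: filterE.
- by apply: filterE; exact: has_deriv_continuous fD.
Qed.

(** Everything is polynomial in [g1] and in the derivatives of [f] along [g], so a bound on [g1], by
    expansion or by closeness to the identity, passes directly to [g2] and [g3]. *)
Lemma inverse_deriv3 f f1 f2 f3 g : has_deriv f f1 -> has_deriv f1 f2 ->
  has_deriv f2 f3 -> continuous f3 ->
  (forall x, f1 x != 0) -> cancel f g -> cancel g f ->
  let g1 := fun x => (f1 (g x))^-1 in
  let g2 := fun x => - (f2 (g x) * g1 x ^+ 3) in
  let g3 := fun x => - (f3 (g x) * g1 x ^+ 4 + 3 * f2 (g x) * g1 x ^+ 2 * g2 x) in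
  [/\ has_deriv g g1, has_deriv g1 g2, has_deriv g2 g3 & continuous g3].
Proof.
move=> fD f1D f2D f3c f1N0 fK gK g1 g2 g3.
have gD : has_deriv g g1 by exact: inverse_deriv.
have g1D : has_deriv g1 g2.
  move=> x; apply: is_derive_eq.
    by apply: is_derive_inv => //; exact: (has_deriv_comp f1D gD).
  by rewrite /g2 /g1 -exprVn; ring.
have g2D : has_deriv g2 g3.
  have H := has_derivM (has_deriv_comp f2D gD) (has_derivM g1D (has_derivM g1D g1D)).
  by have := has_derivZ (-1) H; apply: has_deriv_ext => x; rewrite /g3 /g2; ring.
split => //.
have gc := has_deriv_continuous gD; have g1c := has_deriv_continuous g1D.
have g2c := has_deriv_continuous g2D.
have f2g := has_deriv_continuous (has_deriv_comp f2D gD).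
apply: continuous_opp; apply: continuous_add.
  apply: continuous_mul; last exact: continuous_exp.
  exact: continuous_compose.
apply: continuous_mul => //; apply: continuous_mul; last exact: continuous_exp.
by apply: continuous_mul => //; exact: continuous_cst.
Qed.

Lemma nonvanishing_sign f : continuous f -> (forall x, f x != 0) ->
  exists2 s : R, s * s = 1 & forall x, `|f x| = s * f x.
Proof.
move=> fc fN0.
have pos (x y : R) : 0 < f x * f y.
  wlog xy : x y / x <= y => [H|].
    by have [/H//|/ltW/H] := leP x y; rewrite mulrC.
  have [//|fxy] := ltP 0 (f x * f y).
  have [|z _ fz] := IVT (v := 0) xy (continuous_within_itv fc).
    rewrite ge_min le_max; have := fN0 x; have := fN0 y.
    by case: (ltgtP (f x) 0) => fx //; case: (ltgtP (f y) 0) => fy // _ _; nra.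
  by have := fN0 z; rewrite fz eqxx.
exists (Num.sg (f 0)) => [|x]; first by rewrite -expr2 sqr_sg fN0.
rewrite normrEsg; congr (_ * _); apply/eqP.
have := pos x 0; case: (ltgtP (f x) 0) => [fx|fx|->]; last by rewrite mul0r ltxx.
- by rewrite nmulr_rgt0// => f0; rewrite !ltr0_sg.
- by rewrite pmulr_rgt0// => f0; rewrite !gtr0_sg.
Qed.

(** The lift is a bijection of the line although the circle map is N-to-one. Its derivative vanishes
    nowhere, and [s * f] grows at rate at least [k], so it takes the value [s * c] on [-K, K]. *)
Lemma expanding_bijective f f1 k : has_deriv f f1 -> continuous f1 -> 0 < k ->
  (forall x, k <= `|f1 x|) -> exists2 g, cancel f g & cancel g f.
Proof.
move=> fD f1c k0 f1k.
have f1N0 x : f1 x != 0 by rewrite -normr_gt0 (lt_le_trans k0).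
have [s ss sE] := nonvanishing_sign f1c f1N0.
have finj : injective f.
  move=> x y fxy; have [z _ /eqP] := mean_value x y fD.
  by rewrite fxy subrr eq_sym mulf_eq0 (negbTE (f1N0 z)) subr_eq0 => /eqP.
have sfD := has_derivZ s fD.
have surj c : exists x, f x = c.
  pose K := `|s * c - s * f 0| / k.
  have K0 : 0 <= K by rewrite divr_ge0// ltW.
  have kK : k * K = `|s * c - s * f 0| by rewrite mulrC divfK// gt_eqF.
  have cont : continuous (fun x => s * f x) by exact: has_deriv_continuous sfD.
  have up : s * c <= s * f K.
    have [z _ /eqP] := mean_value 0 K sfD; rewrite subr0 -sE subr_eq => /eqP ->.
    have := ler_wpM2r K0 (f1k z); rewrite kK.
    by have := ler_norm (s * c - s * f 0); lra.
  have lo : s * f (- K) <= s * c.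
    have [z _ /eqP] := mean_value (- K) 0 sfD; rewrite sub0r opprK -sE subr_eq => /eqP.
    have := ler_wpM2r K0 (f1k z); rewrite kK.
    by have := ler_norm (- (s * c - s * f 0)); rewrite normrN; lra.
  have [||x _ xE] := IVT (v := s * c) (a := - K) (b := K) _ (continuous_within_itv cont).
  - lra.
  - by rewrite ge_min lo le_max up orbT.
  by exists x; rewrite -[LHS]mul1r -[RHS]mul1r -ss -!mulrA xE.
have [g gK] := choice surj.
by exists g => // x; apply: finj; rewrite gK.
Qed.

End Branches.

(** * Preimages on the circle through one inverse on the line *)

Section TransferFormula.
Variables (R : realType) (F F1 G : R -> R) (d : int).
Hypotheses (d0 : d != 0) (Fd : forall x, F (x + 1) = F x + d%:~R).
Hypotheses (FD : has_deriv F F1) (FK : cancel F G) (GK : cancel G F).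

Lemma lift_addz (m : int) x : F (x + m%:~R) = F x + (m * d)%:~R.
Proof.
have p : periodic (fun y => F y - y * d%:~R) 1.
  by move=> y; rewrite Fd mulrDl mul1r; ring.
by have := periodic_int p m x; rewrite mulrDl intrM => /eqP; lra.
Qed.

Lemma lift_deriv_periodic : periodic F1 1.
Proof.
move=> x; rewrite -(has_derivE FD).
have := has_derivD FD (has_deriv_cst d%:~R).
rewrite (has_derivE FD) => /has_derivE/(congr1 (@^~ x)); rewrite /= addr0 => <-.
have -> : (fun y => F y + d%:~R) = (fun y => F (y + 1)).
  by apply/funext => y; rewrite Fd.
by rewrite (has_derivE (has_deriv_shift 1 FD)).
Qed.

(** Since [G (x + m * d) = G x + m], the class of [G (x + j)] on the circle depends only on [j]
    modulo [d]; the fibre over [x] is obtained by letting [j] run through the residues. *)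
Lemma branch_bij (x : R) :
  set_bij `I_`|d| [set y | 0 <= y < 1 /\ exists k : int, F y = x + k%:~R]
    (fun j : nat => G (x + j%:R) - (Num.floor (G (x + j%:R)))%:~R).
Proof.
split.
- move=> j _ /=; split.
    by have := floor_itv (G (x + j%:R)); rewrite intrD; lra.
  rewrite -mulrNz lift_addz GK; set m := _ * d; exists (j%:Z + m).
  by rewrite intrD addrA.
- move=> i j; rewrite !inE /= => ilt jlt.
  set a := Num.floor _; set b := Num.floor _ => E.
  have {}E : G (x + i%:R) = G (x + j%:R) + (a - b)%:~R.
    by rewrite intrB; lra.
  have := GK (x + i%:R); rewrite E lift_addz GK -addrA => /addrI /eqP.
  rewrite -[j%:R]/(j%:Z%:~R) -[i%:R]/(i%:Z%:~R) -intrD eqr_int => /eqP ji.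
  have [ab0|ab0] := eqVneq (a - b) 0.
    by move: ji; rewrite ab0 mul0r addr0 => -[].
  have : (`|d| <= `|((a - b) * d)%R|)%N by rewrite abszM leq_pmull// absz_gt0.
  by move: ji ilt jlt; set p := _ * d; clear; lia.
(* The remainder of [k] modulo [d] lies in [0, |d|[ for either sign of [d] and selects the branch;
   the quotient is the integer part that the floor removes. *)
- move=> y /= [/andP[y0 y1] [k Fy]].
  have m0 := modz_ge0 k d0; have mlt := ltz_mod k d0.
  set m := (k %% d)%Z in m0 mlt; set q := (k %/ d)%Z.
  have kE : k = q * d + m by exact: divz_eq.
  have Gm : G (x + `|m|%N%:R) = y + (- q)%:~R.
    rewrite -[RHS]FK lift_addz Fy; congr G; rewrite -addrA; congr (_ + _).
    rewrite -intrD -[`|m|%N%:R]/(`|m|%N%:Z%:~R) gez0_abs//; congr (_%:~R).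
    by rewrite kE mulNr; ring.
  exists `|m|%N => /=; first by move: m0 mlt; lia.
  rewrite Gm (_ : Num.floor _ = - q); first by rewrite addrK.
  by apply: floor_def; rewrite !intrD; lra.
Qed.

Lemma transferE phi x : periodic phi 1 ->
  transfer F phi x =
  \sum_(j < `|d|) phi (G (x + j%:R)) / `|F1 (G (x + j%:R))|.
Proof.
move=> phip; rewrite /transfer (has_derivE FD) (reindex_fsbig _ _ _ _ (branch_bij x)).
rewrite -fsbig_ord; apply: eq_bigr => j _.
by rewrite -mulrNz !periodic_int//; exact: lift_deriv_periodic.
Qed.

Lemma transfer_periodic phi : periodic (transfer F phi) 1.
Proof.
move=> x; rewrite /transfer; apply: eq_fsbigl.
apply/seteqP; split=> y [y01 [k Fy]]; split => //.
  by exists (1 + k); rewrite intrD addrA.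
by exists (k - 1); rewrite Fy intrB; ring.
Qed.

End TransferFormula.

(** * Common form of the transfer operators, with derivatives and bounds *)

Section BranchSums.
Variable R : realType.
Implicit Types (f g phi w : R -> R) (P : (R -> R) -> R -> R) (n : nat).

(** [s] is the constant sign of the derivative of the inverse; it replaces the absolute value in the
    transfer operator, so derivatives pass through the sum. *)
Definition shift_sum (s : R) n w : R -> R :=
  fun x => s * \sum_(j < n) w (x + j%:R).

Lemma shift_sum_deriv s n w w1 :
  has_deriv w w1 -> has_deriv (shift_sum s n w) (shift_sum s n w1).
Proof.
by move=> wD; apply: has_derivZ; apply: has_deriv_sum => j; exact: has_deriv_shift.
Qed.

Lemma shift_sum_continuous s n w : continuous w -> continuous (shift_sum s n w).
Proof.
move=> wc; apply: continuous_mul; first exact: continuous_cst.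
elim: n => [|n IH].
  by under eq_fun do rewrite big_ord0; exact: continuous_cst.
under eq_fun do rewrite big_ord_recr /=.
apply: continuous_add => //; apply: continuous_compose => //.
by apply: continuous_add; [move=> x; exact: cvg_id|exact: continuous_cst].
Qed.

Lemma shift_sum_bound s n w c : s * s = 1 -> (forall x, `|w x| <= c) ->
  forall x, `|shift_sum s n w x| <= n%:R * c.
Proof.
move=> ss wc x; rewrite /shift_sum normrM.
have -> : `|s| = 1.
  by apply/eqP; rewrite -(@eqrXn2 _ 2)// expr1n -normrX expr2 ss normr1.
rewrite mul1r; apply: le_trans; first exact: ler_norm_sum.
have -> : n%:R * c = \sum_(j < n) c by rewrite sumr_const card_ord mulr_natl.
by apply: ler_sum => j _; exact: wc.
Qed.

(* Both the transfer operator of the expanding map and the one of the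
   diffeomorphism Phi (with n = 1) are of this form. *)
Record branch_sum P n (c1 c2 c3 : R) : Type := BranchSum {
  bs_y : R -> R; bs_y1 : R -> R; bs_y2 : R -> R; bs_y3 : R -> R;
  bs_s : R; bs_e : int;
  bs_sign : bs_s * bs_s = 1;
  bs_yD : has_deriv bs_y bs_y1;
  bs_y1D : has_deriv bs_y1 bs_y2;
  bs_y2D : has_deriv bs_y2 bs_y3;
  bs_y3c : continuous bs_y3;
  bs_y1_bound : forall x, `|bs_y1 x| <= c1;
  bs_y2_bound : forall x, `|bs_y2 x| <= c2;
  bs_y3_bound : forall x, `|bs_y3 x| <= c3;
  bs_yn : forall x, bs_y (x + n%:R) = bs_y x + bs_e%:~R;
  bs_periodic : forall phi, periodic phi 1 -> periodic (P phi) 1;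
  bs_E : forall phi, periodic phi 1 ->
    P phi = shift_sum bs_s n (wcomp bs_y bs_y1 phi) }.

Variables (P : (R -> R) -> R -> R) (n : nat) (c1 c2 c3 : R).
Variables (B : branch_sum P n c1 c2 c3).
Local Notation y := (bs_y B).
Local Notation y1 := (bs_y1 B).
Local Notation y2 := (bs_y2 B).
Local Notation y3 := (bs_y3 B).
Local Notation s := (bs_s B).

Lemma branch_sumD f g : periodic f 1 -> periodic g 1 -> P (f + g) = P f + P g.
Proof.
move=> fp gp; rewrite !(bs_E B)//; last by move=> x; rewrite !fctE fp gp.
apply/funext => x; rewrite !fctE /shift_sum -mulrDr -big_split; congr (_ * _).
by apply: eq_bigr => j _; rewrite /wcomp /= mulrDl.
Qed.

Lemma branch_sumZ c f : periodic f 1 -> P (c *: f) = c *: P f.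
Proof.
move=> fp; rewrite !(bs_E B)//; last by move=> x; rewrite !fctE fp.
apply/funext => x; rewrite !fctE /shift_sum /GRing.scale/= mulrCA; congr (_ * _).
by rewrite big_distrr; apply: eq_bigr => j _; rewrite /wcomp/= mulrA.
Qed.

Lemma branch_sumB f g : periodic f 1 -> periodic g 1 -> P (f - g) = P f - P g.
Proof.
move=> fp gp; rewrite -scaleN1r branch_sumD//; last first.
  by move=> x; rewrite !fctE gp.
by rewrite branch_sumZ// scaleN1r.
Qed.

Definition branch_deriv1 phi phi1 : R -> R :=
  shift_sum s n (fun x => phi1 (y x) * y1 x ^+ 2 + phi (y x) * y2 x).

Definition branch_deriv2 phi phi1 phi2 : R -> R :=
  shift_sum s n (fun x => phi2 (y x) * y1 x ^+ 3 + 3 * phi1 (y x) * y1 x * y2 x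
                          + phi (y x) * y3 x).

Lemma branch_sum_deriv1 phi phi1 : periodic phi 1 -> has_deriv phi phi1 ->
  has_deriv (P phi) (branch_deriv1 phi phi1).
Proof.
move=> phip phiD; rewrite (bs_E B)//; apply: shift_sum_deriv.
by apply: wcomp_deriv1 => //; [exact: bs_yD|exact: bs_y1D].
Qed.

Lemma branch_sum_deriv2 phi phi1 phi2 : has_deriv phi phi1 -> has_deriv phi1 phi2 ->
  has_deriv (branch_deriv1 phi phi1) (branch_deriv2 phi phi1 phi2).
Proof.
move=> D1 D2; apply: shift_sum_deriv.
by apply: wcomp_deriv2 => //; [exact: bs_yD|exact: bs_y1D|exact: bs_y2D].
Qed.

Lemma branch_deriv1_continuous phi phi1 : has_deriv phi phi1 -> continuous phi1 ->
  continuous (branch_deriv1 phi phi1).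
Proof.
move=> phiD phi1c; apply: shift_sum_continuous.
have yc := has_deriv_continuous (bs_yD B).
apply: continuous_add; apply: continuous_mul.
- exact: continuous_compose.
- exact/continuous_exp/(has_deriv_continuous (bs_y1D B)).
- exact: continuous_compose (has_deriv_continuous phiD) yc.
- exact: has_deriv_continuous (bs_y2D B).
Qed.

Lemma branch_deriv2_continuous phi phi1 phi2 : has_deriv phi phi1 ->
  has_deriv phi1 phi2 -> continuous phi2 -> continuous (branch_deriv2 phi phi1 phi2).
Proof.
move=> D1 D2 phi2c; apply: shift_sum_continuous.
have yc := has_deriv_continuous (bs_yD B).
have y1c := has_deriv_continuous (bs_y1D B).
have y2c := has_deriv_continuous (bs_y2D B).
apply: continuous_add; last first.
  apply: continuous_mul; last exact: bs_y3c.
  exact: continuous_compose (has_deriv_continuous D1) yc.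
apply: continuous_add.
  by apply: continuous_mul; [exact: continuous_compose|exact: continuous_exp].
apply: continuous_mul => //; apply: continuous_mul => //.
by apply: continuous_scale; exact: continuous_compose (has_deriv_continuous D2) yc.
Qed.

(* If w' = phi then P phi is, up to sign, the derivative of the sum of the
   w (y (x + j)), whose increment over a period telescopes. *)
Lemma branch_sum_mean0 phi phi1 : periodic phi 1 -> has_deriv phi phi1 ->
  circle_mean phi = 0 -> circle_mean (P phi) = 0.
Proof.
move=> phip phiD phi0; have phic := has_deriv_continuous phiD.
have [w wD wp] := periodic_primitive phip phic phi0.
have PD : has_deriv (shift_sum s n (fun x => w (y x))) (P phi).
  by rewrite (bs_E B)//; apply: shift_sum_deriv; exact: has_deriv_comp wD (bs_yD B).
have Pc := has_deriv_continuous (branch_sum_deriv1 phip phiD).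
rewrite (circle_mean_deriv PD Pc) /shift_sum -mulrBr -sumrB.
rewrite (eq_bigr (fun j : 'I_n => w (y j.+1%:R) - w (y j%:R))); last first.
  by move=> j _; rewrite add0r nat1r.
rewrite -(big_mkord xpredT (fun j => w (y j.+1%:R) - w (y j%:R))) telescope_sumr//.
by rewrite -[n%:R]add0r (bs_yn B) periodic_int// subrr mulr0.
Qed.

Lemma branch_sum_bound phi b0 : periodic phi 1 -> (forall x, `|phi x| <= b0) ->
  forall x, `|P phi x| <= n%:R * (b0 * c1).
Proof.
move=> phip phib; rewrite (bs_E B)//; apply: shift_sum_bound => [|x].
  exact: bs_sign.
by rewrite /wcomp normrM ler_pM//; exact: bs_y1_bound.
Qed.

Lemma branch_deriv1_bound phi phi1 b0 b1 : (forall x, `|phi x| <= b0) ->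
  (forall x, `|phi1 x| <= b1) ->
  forall x, `|branch_deriv1 phi phi1 x| <= n%:R * (b1 * c1 ^+ 2 + b0 * c2).
Proof.
move=> phib phi1b; apply: shift_sum_bound => [|x]; first exact: bs_sign.
apply: (le_trans (ler_normD _ _)); rewrite [X in X + _]normrM.
rewrite [X in _ + X]normrM normrX; apply: lerD; apply: ler_pM => //; last exact: bs_y2_bound.
by rewrite lerXn2r ?nnegrE//; [exact: le_trans (bs_y1_bound B 0)|exact: bs_y1_bound].
Qed.

Lemma branch_deriv2_bound phi phi1 phi2 b0 b1 b2 : (forall x, `|phi x| <= b0) ->
  (forall x, `|phi1 x| <= b1) -> (forall x, `|phi2 x| <= b2) ->
  forall x, `|branch_deriv2 phi phi1 phi2 x|
    <= n%:R * (b2 * c1 ^+ 3 + 3 * b1 * c1 * c2 + b0 * c3).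
Proof.
move=> phib phi1b phi2b; apply: shift_sum_bound => [|x]; first exact: bs_sign.
have h1 := bs_y1_bound B x; have h2 := bs_y2_bound B x; have h3 := bs_y3_bound B x.
have c10 : 0 <= c1 by exact: le_trans h1.
apply: (le_trans (ler_normD _ _)); apply: lerD; last by rewrite normrM ler_pM.
apply: (le_trans (ler_normD _ _)); rewrite [X in X + _]normrM.
rewrite normrX !(normrM (_ * _)) normrM normr_nat; apply: lerD.
  by rewrite ler_pM// lerXn2r.
by rewrite ler_pM// ?mulr_ge0// ler_pM// ?mulr_ge0// ler_pM.
Qed.

Lemma branch_sum_C1_mean0 phi : C1_mean0 phi -> C1_mean0 (P phi).
Proof.
move=> /C1_mean0P[phip phiD phic phi0].
apply: (C1_mean0_intro _ (branch_sum_deriv1 phip phiD)).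
- exact: bs_periodic B _ phip.
- exact: branch_deriv1_continuous.
- exact: branch_sum_mean0 phiD _.
Qed.

(** For [P], with [c1 = omega^-1] and [c2 = max |F''| / omega ^+ 3], the factor is the left side of
    the degree condition. For [Q], with [n = 1], it is [(1 + 2 * e) ^+ 2 + 8 * e], close to 1. *)
Lemma branch_sum_contraction phi c : C1_mean0 phi ->
  (forall x, `|derive1 phi x| <= c) ->
  forall x, `|derive1 (P phi) x| <= n%:R * (c1 ^+ 2 + c2) * c.
Proof.
move=> phiX phi1b x; have [phip phiD _ _] := (C1_mean0P _).1 phiX.
rewrite (has_derivE (branch_sum_deriv1 phip phiD)) -mulrA mulrDl ![_ * c]mulrC.
by apply: branch_deriv1_bound => //; exact: C1_mean0_bound.
Qed.

End BranchSums.

(** * The coupling kernel *)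

Section Kernel.
Variable R : realType.
Implicit Types (h : R -> R -> R) (g r : R -> R) (H b : R).

Lemma deriv_withinT_is_derive g (t l : R) :
  deriv_within setT g t l -> is_derive t (1 : R) g l.
Proof.
move=> /cvgrPdist_le gl; apply/is_derive_epsP => e /gl.
rewrite !near_withinE; apply: filterS => y.
have [->|yt /(_ isT I)] := eqVneq y t; first by rewrite !subrr mulr0 subrr !normr0 mulr0.
have yt0 : y - t != 0 by rewrite subr_eq0.
rewrite -(ler_pM2r (x := `|y - t|)) ?normr_gt0// -normrM.
apply: le_trans; by rewrite -normrN le_eqVlt; apply/orP; left; apply/eqP; congr (`|_|); field.
Qed.

Lemma CkT2_deriv k h : CkT2 k.+1 h ->
  exists2 h1, CkT2 k h1 & forall y, has_deriv (h ^~ y) (h1 ^~ y).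
Proof.
move=> [p1 p2 [_ [h1 [h2 [D1 _ C1 _]]]]].
have hD y : has_deriv (h ^~ y) (h1 ^~ y).
  by move=> x; apply: deriv_withinT_is_derive; exact: D1.
exists h1 => //; split => // [y|x y].
- exact: has_deriv_periodic (hD y).
- have E z : h1 x z = derive1 (h ^~ z) x by rewrite (has_derivE (hD z)).
  by rewrite !E; congr (derive1 _ x); apply/funext => z; rewrite p2.
Qed.

Lemma CkT2_continuous k h : CkT2 k h -> continuous (fun p : R * R => h p.1 p.2).
Proof.
by move=> [_ _]; case: k => [|k] [+ _];
  rewrite setXTT => hc; exact/continuous_subspace_setT.
Qed.

Lemma CkT2_bounded k h : CkT2 k h -> exists H, forall x y, `|h x y| <= H.
Proof.
move=> hk; have hc := CkT2_continuous hk; have [p1 p2 _] := hk.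
have K : compact (`[0, 1]%classic `*` `[0, 1]%classic : set (R * R)).
  by apply: compact_setX; exact: segment_compact.
have hK : compact ((fun p : R * R => h p.1 p.2) @` (`[0, 1] `*` `[0, 1])).
  by apply: continuous_compact => //; exact: continuous_subspaceT.
have [M [_ /(_ (M + 1))]] := compact_bounded hK.
rewrite ltrDl ltr01 => /(_ isT) HM; exists (M + 1) => x y.
have [x' /andP[x0 x1] ->] := periodic_reduce (p1 y) x.
have [y' /andP[y0 y1] ->] := periodic_reduce (p2 x') y.
by apply: HM; exists (x', y') => //; split; rewrite /= in_itv/= ?x0 ?y0 ltW.
Qed.

(** [kd i] is the derivative of order [i] of [h] in the first variable. Three derivatives of [Phi]
    are taken, and differentiating once more under the integral needs a bound on the next order,
    hence 4. *)
Record kernel_data h : Type := KernelData {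
  kd : nat -> R -> R -> R; kd_bound : R;
  kd_0 : kd 0 = h;
  kd_periodic : forall i, (i <= 4)%N -> forall y, periodic (kd i ^~ y) 1;
  kd_continuous : forall i, (i <= 4)%N -> forall x, continuous (kd i x);
  kd_le : forall i, (i <= 4)%N -> forall x y, `|kd i x y| <= kd_bound;
  kd_deriv : forall i, (i < 4)%N -> forall y, has_deriv (kd i ^~ y) (kd i.+1 ^~ y) }.

Lemma CkT2_kernel_data h : CkT2 5 h -> inhabited (kernel_data h).
Proof.
move=> h0; have [h1 /[dup] k1 /CkT2_deriv[h2 k2 D1] D0] := CkT2_deriv h0.
have [h3 /[dup] k3 /CkT2_deriv[h4 k4 D3] D2] := CkT2_deriv k2.
have [H0 B0] := CkT2_bounded h0; have [H1 B1] := CkT2_bounded k1.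
have [H2 B2] := CkT2_bounded k2; have [H3 B3] := CkT2_bounded k3.
have [H4 B4] := CkT2_bounded k4.
pose H := `|H0| + `|H1| + `|H2| + `|H3| + `|H4|.
have slice k' (u : R -> R -> R) : CkT2 k' u -> forall x, continuous (u x).
  move=> /CkT2_continuous uc x y.
  apply: (@continuous_comp _ _ _ (fun y => (x, y)) (fun p : R * R => u p.1 p.2)).
    by apply: (@cvg_pair _ _ _ _ (nbhs x) (nbhs y)); [exact: cvg_cst|exact: cvg_id].
  exact: uc.
have nrm (x : R) : x <= `|x| /\ 0 <= `|x| by rewrite ler_norm.
have [? ?] := nrm H0; have [? ?] := nrm H1; have [? ?] := nrm H2.
have [? ?] := nrm H3; have [? ?] := nrm H4.
apply: inhabits; apply: (@KernelData h (nth h [:: h; h1; h2; h3; h4]) H) => //.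
- by do 5?[case=> //]; move=> _ y; [case: h0|case: k1|case: k2|case: k3|case: k4].
- do 5?[case=> //]; move=> _;
    [exact: slice h0|exact: slice k1|exact: slice k2|exact: slice k3|exact: slice k4].
- do 5?[case=> //]; move=> _ x y /=;
    [move: (B0 x y)|move: (B1 x y)|move: (B2 x y)|move: (B3 x y)|move: (B4 x y)];
    rewrite /H; lra.
- by do 4?[case=> //].
Qed.

Variables (h : R -> R -> R) (D : kernel_data h).
Local Notation hh := (kd D).
Local Notation H := (kd_bound D).

Lemma kd_bound_ge0 : 0 <= H.
Proof. exact: le_trans (normr_ge0 _) (kd_le (i := 0) D isT 0 0). Qed.

Lemma A_continuous_integrand i x g : (i <= 4)%N -> continuous g ->
  continuous (fun y => hh i x y * g y).
Proof. by move=> i4 gc; apply: continuous_mul => //; exact: kd_continuous. Qed.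

Lemma AE i g x : A (hh i) g x = circle_mean (fun y => hh i x y * g y).
Proof. by []. Qed.

Lemma A_periodic i g : (i <= 4)%N -> periodic (A (hh i) g) 1.
Proof.
by move=> i4 x; rewrite !AE; congr circle_mean; apply/funext => y; rewrite kd_periodic.
Qed.

Lemma A_bound i g b : (i <= 4)%N -> continuous g -> (forall x, `|g x| <= b) ->
  forall x, `|A (hh i) g x| <= H * b.
Proof.
move=> i4 gc gb x; apply: circle_mean_bounded => [|y].
  exact: A_continuous_integrand.
by rewrite normrM ler_pM//; exact: kd_le.
Qed.

(** Mass one makes the bound independent of [r]: how close [Phi] is to the identity is thus known
    before any estimate on the fixed density. *)
Lemma A_density_bound i r : (i <= 4)%N -> continuous r -> (forall x, 0 <= r x) ->
  circle_mean r = 1 -> forall x, `|A (hh i) r x| <= H.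
Proof.
move=> i4 rc r0 r1 x; rewrite -[leRHS]mulr1 -r1.
by apply: circle_mean_weighted => //; [exact: kd_continuous|exact: kd_le].
Qed.

Lemma AD i f g : (i <= 4)%N -> continuous f -> continuous g ->
  A (hh i) (fun x => f x + g x) = fun x => A (hh i) f x + A (hh i) g x.
Proof.
move=> i4 fc gc; apply/funext => x; rewrite !AE -circle_meanD.
- by congr circle_mean; apply/funext => y; rewrite mulrDr.
- exact: A_continuous_integrand.
- exact: A_continuous_integrand.
Qed.

Lemma AZ i c g : (i <= 4)%N -> continuous g ->
  A (hh i) (fun x => c * g x) = fun x => c * A (hh i) g x.
Proof.
move=> i4 gc; apply/funext => x; rewrite !AE -circle_meanZ.
- by congr circle_mean; apply/funext => y; rewrite mulrCA.
- exact: A_continuous_integrand.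
Qed.

(** The quadratic Taylor bound of the kernel is uniform in both variables and can be integrated. It
    uses the derivative of order [i + 2], whence the condition on [i]. *)
Lemma A_deriv i g : (i.+1 < 4)%N -> continuous g -> periodic g 1 ->
  has_deriv (A (hh i) g) (A (hh i.+1) g).
Proof.
move=> i4 gc gp x; have [b gb] := continuous_periodic_bounded gp gc.
have b0 : 0 <= b by exact: le_trans (gb 0).
have i4' : (i < 4)%N by exact: ltnW.
have quad z : `|A (hh i) g z - A (hh i) g x - A (hh i.+1) g x * (z - x)|
    <= H * b * `|z - x| ^+ 2.
  have c1 := A_continuous_integrand (x := x) (ltnW i4') gc.
  have c2 := A_continuous_integrand (x := z) (ltnW i4') gc.
  have c3 := A_continuous_integrand (x := x) i4' gc.
  rewrite mulrC !AE -circle_meanB// -circle_meanZ// -circle_meanB//; last 2 first.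
  - by apply: continuous_add => //; exact: continuous_opp.
  - exact: continuous_scale.
  have c4 : continuous (fun y => hh i z y * g y - hh i x y * g y - (z - x) * (hh i.+1 x y * g y)).
    apply: continuous_add; last first.
      by apply: continuous_opp; exact: continuous_scale.
    by apply: continuous_add => //; exact: continuous_opp.
  apply: circle_mean_bounded => // y.
  have -> : hh i z y * g y - hh i x y * g y - (z - x) * (hh i.+1 x y * g y) =
    (hh i z y - hh i x y - hh i.+1 x y * (z - x)) * g y by ring.
  rewrite normrM mulrAC ler_pM//.
  apply: (taylor1_bound (kd_deriv D i4' y) (kd_deriv D i4 y)) => u.
  exact: kd_le.
apply/is_derive_epsP => e e0.
have d0 : 0 < e / (H * b + 1) by rewrite divr_gt0// ltr_wpDl// mulr_ge0// kd_bound_ge0.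
apply: filterS (near_dist_le x d0) => z zx; apply: le_trans (quad z) _.
rewrite expr2 mulrA ler_wpM2r//.
have Hb : 0 <= H * b by rewrite mulr_ge0// kd_bound_ge0.
apply: (@le_trans _ _ ((H * b + 1) * (e / (H * b + 1)))).
  by rewrite ler_pM// lerDl.
by rewrite mulrC divfK// gt_eqF// ltr_wpDl.
Qed.

Lemma A_continuous i g : (i < 4)%N -> continuous g -> periodic g 1 ->
  continuous (A (hh i) g).
Proof.
move=> i4 gc gp; have [b gb] := continuous_periodic_bounded gp gc.
have b0 : 0 <= b by exact: le_trans (gb 0).
have lip x z : `|A (hh i) g x - A (hh i) g z| <= H * b * `|z - x|.
  have c1 := A_continuous_integrand (x := x) (ltnW i4) gc.
  have c2 := A_continuous_integrand (x := z) (ltnW i4) gc.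
  rewrite !AE -circle_meanB//; apply: circle_mean_bounded => [|y].
    by apply: continuous_add => //; exact: continuous_opp.
  rewrite -mulrBl normrM mulrAC ler_pM// distrC.
  by apply: (lipschitz_of_deriv (kd_deriv D i4 y)) => u; exact: kd_le.
move=> x; apply/cvgrPdist_le => e e0.
have Hb : 0 <= H * b by rewrite mulr_ge0// kd_bound_ge0.
have d0 : 0 < e / (H * b + 1) by rewrite divr_gt0// ltr_wpDl.
apply: filterS (near_dist_le x d0) => z zx; apply: le_trans (lip x z) _.
apply: (@le_trans _ _ ((H * b + 1) * (e / (H * b + 1)))).
  by rewrite ler_pM// lerDl.
by rewrite mulrC divfK// gt_eqF// ltr_wpDl.
Qed.

End Kernel.

(** * The expanding map and the coupling map as branch sums *)

Section Instances.
Variable R : realType.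

Lemma Ck_deriv k (f : R -> R) i : Ck k f -> (i < k)%N ->
  has_deriv (derive1n i f) (derive1n i.+1 f).
Proof. by move=> [fD _] ik; exact: derivable_has_deriv (fD i ik). Qed.

(** The first two constants are explicit because the degree condition is about them; [c3] enters
    only the bound on the second derivative of the fixed density. *)
Lemma expanding_branch_sum (N : nat) (omega : R) (F : R -> R) :
  1 < omega -> Ck 5 F -> covering_lift N F ->
  (forall x, omega < `|derive1 F x|) ->
  exists c3, inhabited (branch_sum (transfer F) N omega^-1
    (sup [set `|derive1n 2 F x| | x in [set: R]] / omega ^+ 3) c3).
Proof.
move=> w1 FC [d dN Fd] Fexp.
have w0 : 0 < omega by rewrite (lt_trans ltr01).
have D0 := Ck_deriv FC (i := 0) isT; have D1 := Ck_deriv FC (i := 1) isT.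
have D2 := Ck_deriv FC (i := 2) isT; have D3 := Ck_deriv FC (i := 3) isT.
rewrite derive1n0 derive1n1 in D0; rewrite derive1n1 in D1.
set F1 := derive1 F in Fexp D0 D1; set F2 := derive1n 2 F in D1 D2 *.
set F3 := derive1n 3 F in D2 D3.
have F1N0 x : F1 x != 0 by rewrite -normr_gt0 (lt_trans w0).
have [G FK GK] := expanding_bijective D0 (has_deriv_continuous D1) w0
  (fun x => ltW (Fexp x)).
have p1 : periodic F1 1 by exact: lift_deriv_periodic Fd D0.
have p2 := has_deriv_periodic p1 D1; have p3 := has_deriv_periodic p2 D2.
have [s ss sE] := nonvanishing_sign (has_deriv_continuous D1) F1N0.
have d0 : d != 0.
  apply/eqP => d0; have /eqP := FK 1; rewrite -[1]add0r Fd d0 addr0 FK add0r.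
  by rewrite eq_sym oner_eq0.
have [M0 M0P] := continuous_periodic_bounded p2 (has_deriv_continuous D2).
have [M3 M3P] := continuous_periodic_bounded p3 (has_deriv_continuous D3).
set M := sup _.
have MP x : `|F2 x| <= M.
  apply: ub_le_sup; last by exists x.
  by exists M0 => _ [y _ <-].
have M_ge0 : 0 <= M by exact: le_trans (MP 0).
have M3_ge0 : 0 <= M3 by exact: le_trans (M3P 0).
have [GD G1D G2D G3c] := inverse_deriv3 D0 D1 D2 (has_deriv_continuous D3) F1N0 FK GK.
set G1 := (fun x => (F1 (G x))^-1) in GD G1D G2D G3c.
set G2 := (fun x => - (F2 (G x) * G1 x ^+ 3)) in G1D G2D G3c.
set G3 := (fun x => - (F3 (G x) * _ + _)) in G2D G3c.
have G1b x : `|G1 x| <= omega^-1.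
  by rewrite /G1 normfV lef_pV2 ?posrE ?normr_gt0//; exact/ltW/Fexp.
have G1n n x : `|G1 x ^+ n| <= omega^-1 ^+ n.
  by rewrite normrX lerXn2r ?nnegrE ?invr_ge0// ltW.
have G2b x : `|G2 x| <= M / omega ^+ 3.
  rewrite /G2 normrN; apply: norm_mul_le; first exact: MP.
  by rewrite -exprVn; exact: (G1n 3%N x).
exists (M3 * omega^-1 ^+ 4 + 3 * M * omega^-1 ^+ 2 * (M / omega ^+ 3)).
apply: inhabits; apply: (@BranchSum _ _ _ _ _ _ G G1 G2 G3 s (Num.sg d)) => //.
- move=> x; rewrite /G3 normrN; apply: (le_trans (ler_normD _ _)).
  apply: lerD; first exact: norm_mul_le (M3P _) (G1n 4%N x).
  apply: norm_mul_le (G2b x); apply: norm_mul_le (G1n 2%N x).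
  by apply: norm_mul_le (MP _); rewrite normr_nat.
(* [N] equals [sg d * d], which is what [F] gains when its argument moves by [sg d]. *)
- by move=> x; rewrite -{1}[x]GK -dN -[_%:R]/(_%:Z%:~R) abszE normrEsg
    -(lift_addz Fd) FK.
- by move=> phi _; exact: transfer_periodic.
- move=> phi phip; apply/funext => x; rewrite (transferE d0 Fd D0 FK GK)// dN.
  rewrite /shift_sum mulr_sumr; apply: eq_bigr => j _; rewrite /wcomp sE invfM.
  have -> : s^-1 = s by rewrite -[LHS]mulr1 -ss mulKf//; apply/eqP => s0;
    move/eqP: ss; rewrite s0 mul0r eq_sym oner_eq0.
  by rewrite mulrCA.
Qed.

Section Coupling.
Variables (h : R -> R -> R) (D : kernel_data h).
Local Notation hh := (kd D).
Local Notation H := (kd_bound D).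
Implicit Types (t e : R) (r g phi : R -> R).

Lemma A_kd0 : A h = A (hh 0).
Proof. by rewrite kd_0. Qed.

Definition Phi1 t r (x : R) : R := 1 + t * A (hh 1) r x.

Lemma Phi_deriv t r : continuous r -> periodic r 1 ->
  has_deriv (Phi h t r) (Phi1 t r).
Proof.
move=> rc rp; apply: has_derivD; first exact: has_deriv_id.
by apply: has_derivZ; rewrite A_kd0; exact: A_deriv.
Qed.

Lemma Phi_invK t r : circle_diffeo (Phi h t r) ->
  cancel (Phi h t r) (Phi_inv h t r) /\ cancel (Phi_inv h t r) (Phi h t r).
Proof.
move=> [_ [g fg gf] _ _].
have inj : {in [set: R] &, injective (Phi h t r)}.
  by move=> x y _ _; exact: (can_inj fg).
split=> x; first by apply: pinvKV; rewrite ?inE.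
by apply: pinvK; rewrite inE; exists (g x).
Qed.

Lemma QE t r phi : continuous r -> periodic r 1 ->
  Q h t r phi = wcomp (Phi_inv h t r) (fun x => (Phi1 t r (Phi_inv h t r x))^-1) phi.
Proof.
by move=> rc rp; rewrite /Q (has_derivE (Phi_deriv t rc rp)).
Qed.

(** This brings [K] under the lemmas on branch sums. One derivative of [K] then costs two
    derivatives of [r]. *)
Lemma KE t r g :
  K h t r g = derive1 (Q h t r (fun x => r x * A h g x)).
Proof.
by rewrite /K /Q; congr derive1; apply/funext => x /=; rewrite mulrAC.
Qed.

(** The derivatives of [Phi] are within [e] of those of the identity. So
    [z1 <= 1 / (1 - e) <= 1 + 2 * e <= 2], then [|z2| <= e * 2^3], and
    [|z3| <= 16 * e + 96 * e^2 <= 32] for [e <= 1/2]. The first two bounds tend to those of the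
    identity as [e] tends to 0. *)
Lemma coupling_branch_sum t r (e : R) : continuous r -> periodic r 1 ->
  (forall x, 0 <= r x) -> circle_mean r = 1 -> circle_diffeo (Phi h t r) ->
  `|t| * H <= e -> e <= 2^-1 ->
  inhabited (branch_sum (Q h t r) 1 (1 + 2 * e) (8 * e) 32).
Proof.
move=> rc rp r0 r1 diff te e2; have [PK KP] := Phi_invK diff.
have D0 := Phi_deriv t rc rp.
have D1 : has_deriv (Phi1 t r) (fun x => t * A (hh 2) r x).
  have := has_derivD (has_deriv_cst 1) (has_derivZ t (A_deriv D (i := 1) isT rc rp)).
  by apply: has_deriv_ext => x //; rewrite add0r.
have D2 : has_deriv (fun x => t * A (hh 2) r x) (fun x => t * A (hh 3) r x).
  by apply: has_derivZ; exact: A_deriv.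
have D3 : continuous (fun x => t * A (hh 3) r x).
  by apply: continuous_scale; exact: A_continuous.
have Pb i x : (i <= 4)%N -> `|t * A (hh i) r x| <= e.
  move=> i4; rewrite normrM; apply: le_trans te; rewrite ler_wpM2l//.
  exact: A_density_bound.
have e0 : 0 <= e by exact: le_trans (normr_ge0 _) (Pb 0%N 0 isT).
have P1ge x : 1 - e <= Phi1 t r x.
  by have := Pb 1%N x isT; rewrite /Phi1 ler_norml => /andP[]; lra.
have P1N0 x : Phi1 t r x != 0 by rewrite gt_eqF// (lt_le_trans _ (P1ge x))//; lra.
set z := Phi_inv h t r in PK KP *.
have [zD z1D z2D z3c] := inverse_deriv3 D0 D1 D2 D3 P1N0 PK KP.
set z1 := (fun x => (Phi1 t r (z x))^-1) in zD z1D z2D z3c.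
set z2 := (fun x => - (_ * z1 x ^+ 3)) in z1D z2D z3c.
set z3 := (fun x => - (_ * z1 x ^+ 4 + _)) in z2D z3c.
have z1b x : `|z1 x| <= 1 + 2 * e.
  have P0 : 0 < Phi1 t r (z x) by rewrite (lt_le_trans _ (P1ge _))//; lra.
  rewrite /z1 normfV gtr0_norm// -div1r ler_pdivrMr//.
  have := P1ge (z x); nra.
have z1b2 x : `|z1 x| <= 2 by apply: le_trans (z1b x) _; lra.
have z1n n x : `|z1 x ^+ n| <= 2 ^+ n by rewrite normrX lerXn2r ?nnegrE.
have z2b x : `|z2 x| <= 8 * e.
  rewrite /z2 normrN normrM [leRHS]mulrC ler_pM ?Pb//.
  by apply: le_trans (z1n 3%N x) _; rewrite -natrX.
have p1 : periodic (Phi1 t r) 1 by move=> x; rewrite /Phi1 (A_periodic D).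
apply: inhabits; apply: (@BranchSum _ _ _ _ _ _ z z1 z2 z3 1 1) => //.
- by rewrite mulr1.
- move=> x; rewrite /z3 normrN; apply: (le_trans (ler_normD _ _)).
  have h1 : `|t * A (hh 3) r (z x) * z1 x ^+ 4| <= e * 2 ^+ 4.
    by rewrite normrM ler_pM ?Pb.
  have h2 : `|3 * (t * A (hh 2) r (z x)) * z1 x ^+ 2 * z2 x| <=
      3 * e * 2 ^+ 2 * (8 * e).
    rewrite normrM ler_pM// normrM ler_pM// normrM ler_pM// ?Pb//.
    by rewrite ger0_norm.
  by apply: le_trans (lerD h1 h2) _; rewrite !exprS expr0; nra.
- by move=> x; rewrite -{1}[x]KP; have [Ps _ _ _] := diff; rewrite -Ps PK.
- move=> phi phip x; rewrite QE// /wcomp -/z.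
  have -> : z (x + 1) = z x + 1 by rewrite -{1}[x]KP; have [Ps _ _ _] := diff; rewrite -Ps PK.
  by rewrite phip p1.
- move=> phi phip; rewrite QE//; apply/funext => x.
  by rewrite /shift_sum mul1r big_ord1 addr0.
Qed.

End Coupling.
End Instances.

(** * The perturbed operator *)

Section FixedDensityBounds.
Variable R : realType.
Implicit Types (r : R -> R).
Variables (P Q : (R -> R) -> R -> R) (N : nat) (a b c e k : R).
Hypotheses (BP : branch_sum P N a b c) (BQ : branch_sum Q 1 (1 + 2 * e) (8 * e) 32).
Hypotheses (e0 : 0 <= e) (e2 : e <= 2^-1) (k1 : k < 1).
Hypothesis Pk : N%:R * (a ^+ 2 + b) * (1 + 14 * e) <= k.

(* Fixed points of the Lasota-Yorke inequalities for the first and the second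
   derivative of P (Q r). *)
Definition fixed_C1 : R := 4 / (1 - k).
Definition fixed_C0 : R := 1 + fixed_C1.
Definition fixed_C2 : R :=
  N%:R * ((24 * fixed_C1 + 32 * fixed_C0) * a ^+ 3
    + 12 * (fixed_C1 + fixed_C0) * a * b + 2 * fixed_C0 * c) / (1 - k).

(** As [r = P (Q r)], each derivative of [r] is given by a branch formula in the derivatives of [r]
    itself, with leading coefficient at most [k < 1]. Periodicity and continuity supply the finite
    bound from which [self_improving_bound] starts. *)
Lemma fixed_density_bounds r (r1 r2 : R -> R) : periodic r 1 -> has_deriv r r1 ->
  has_deriv r1 r2 -> continuous r2 -> circle_mean r = 1 -> P (Q r) = r ->
  [/\ forall x, `|r x| <= fixed_C0, forall x, `|r1 x| <= fixed_C1
    & forall x, `|r2 x| <= fixed_C2].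
Proof.
move=> rp rD r1D r2c r_mean PQr.
have a0 : 0 <= a by exact: le_trans (normr_ge0 _) (bs_y1_bound BP 0).
have b0 : 0 <= b by exact: le_trans (normr_ge0 _) (bs_y2_bound BP 0).
have c0 : 0 <= c by exact: le_trans (normr_ge0 _) (bs_y3_bound BP 0).
have n0 : 0 <= N%:R :> R by [].
have X0 : 0 <= N%:R * a ^+ 2 by rewrite mulr_ge0// exprn_ge0.
have Y0 : 0 <= N%:R * b by rewrite mulr_ge0.
have XY : N%:R * a ^+ 2 + N%:R * b <= 1.
  have : 0 <= (N%:R * a ^+ 2 + N%:R * b) * e by rewrite mulr_ge0// addr_ge0.
  by move: Pk k1; lra.
have C1_ge0 : 0 <= fixed_C1 by rewrite divr_ge0// subr_ge0 ltW.
have Qp : periodic (Q r) 1 by exact: bs_periodic BQ _ rp.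
have QD := branch_sum_deriv1 BQ rp rD; have Q1D := branch_sum_deriv2 BQ rD r1D.
have PD := branch_sum_deriv1 BP Qp QD; have P1D := branch_sum_deriv2 BP QD Q1D.
rewrite PQr in PD.
have r1E : r1 = branch_deriv1 BP (Q r) (branch_deriv1 BQ r r1).
  exact: etrans (esym (has_derivE rD)) (has_derivE PD).
have r2E : r2 = branch_deriv2 BP (Q r) (branch_deriv1 BQ r r1) (branch_deriv2 BQ r r1 r2).
  by have := has_derivE r1D; rewrite {1}r1E (has_derivE P1D).
have r_bound C : (forall x, `|r1 x| <= C) -> forall x, `|r x| <= 1 + C.
  move=> r1C x; have := dist_circle_mean rp rD r1C x.
  rewrite r_mean !ler_norml => /andP[]; have := le_trans (normr_ge0 _) (r1C 0).
  by move=> ? ? ?; apply/andP; split; lra.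
have r1p := has_deriv_periodic rp rD; have r2p := has_deriv_periodic r1p r1D.
have B1 : forall x, `|r1 x| <= fixed_C1.
  apply: self_improving_bound => //.
    by apply: continuous_periodic_bounded => //; exact: has_deriv_continuous r1D.
  move=> C r1C x; have rC := r_bound C r1C.
  have C0 : 0 <= C by exact: le_trans (normr_ge0 _) (r1C 0).
  have h0 := branch_sum_bound BQ rp rC; have h1 := branch_deriv1_bound BQ rC r1C.
  rewrite {1}r1E; apply: le_trans (branch_deriv1_bound BP h0 h1 x) _.
  rewrite !mul1r.
  (* For [e <= 1/2], [(1 + 2 * e) ^+ 2 + 8 * e <= 1 + 14 * e], and the constant part is at most 4:
     these are the 14 of [Pk] and the 4 of [fixed_C1]. *)
  have Ce : 0 <= C * (e * (2^-1 - e)).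
    by rewrite mulr_ge0// mulr_ge0// subr_ge0.
  have Ce0 : 0 <= C * e by rewrite mulr_ge0.
  have t1 : N%:R * a ^+ 2 * (C * (1 + 2 * e) ^+ 2 + (1 + C) * (8 * e))
      <= N%:R * a ^+ 2 * ((1 + 14 * e) * C + 4).
    by rewrite ler_wpM2l// expr2; move: e0 e2 Ce Ce0; lra.
  have t2 : N%:R * b * ((1 + C) * (1 + 2 * e)) <= N%:R * b * ((1 + 14 * e) * C + 4).
    by rewrite ler_wpM2l//; move: e0 e2 Ce Ce0; lra.
  have t3 : N%:R * (a ^+ 2 + b) * (1 + 14 * e) * C <= k * C by rewrite ler_wpM2r.
  by move: t1 t2 t3 XY; lra.
have B0 : forall x, `|r x| <= fixed_C0 by exact: r_bound.
split => //.
have C0_ge0 : 0 <= fixed_C0 by rewrite addr_ge0.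
apply: self_improving_bound => //; first exact: continuous_periodic_bounded.
move=> C r2C x.
have C0 : 0 <= C by exact: le_trans (normr_ge0 _) (r2C 0).
have h0 := branch_sum_bound BQ rp B0; have h1 := branch_deriv1_bound BQ B0 B1.
have h2 := branch_deriv2_bound BQ B0 B1 r2C.
rewrite {1}r2E; apply: le_trans (branch_deriv2_bound BP h0 h1 h2 x) _.
rewrite !mul1r.
set q := 1 + 2 * e in h0 h1 h2 *.
have q1 : 1 <= q by move: e0; rewrite /q; lra.
have q0 : 0 <= q by exact: le_trans q1.
have q2 : q <= 2 by move: e2; rewrite /q; lra.
have Xq : N%:R * a ^+ 2 * q ^+ 2 <= k.
  apply: le_trans Pk.
  apply: (@le_trans _ _ (N%:R * a ^+ 2 * (1 + 14 * e))).
    by rewrite ler_wpM2l// /q expr2; move: e0 e2; nra.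
  by rewrite ler_wpM2r ?ler_wpM2l ?lerDl//; move: e0; lra.
(* The second derivative gains a further factor [a * q], at most 1 because
   [N * (a * q) ^+ 2 <= k < 1] and [N >= 1]; for [N = 0] both sides of [Xq] and of the goal
   agree. *)
have aq : N%:R * a ^+ 3 * q ^+ 3 <= k.
  have [N0|N0] := posnP N.
    by move: Xq; rewrite N0 !mul0r.
  have aq1 : a * q <= 1.
    rewrite -(@expr_le1 _ 2)//; last exact: mulr_ge0.
    rewrite exprMn; apply: le_trans (ltW k1); apply: le_trans Xq.
    by rewrite -mulrA ler_peMl ?ler1n//; apply: mulr_ge0; exact: exprn_ge0.
  have -> : N%:R * a ^+ 3 * q ^+ 3 = N%:R * a ^+ 2 * q ^+ 2 * (a * q) by ring.
  apply: le_trans Xq; rewrite ler_piMr//.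
  by apply: mulr_ge0 => //; exact: exprn_ge0.
have s2 : N%:R * a ^+ 3 * (3 * fixed_C1 * q * (8 * e)) <= N%:R * a ^+ 3 * (24 * fixed_C1).
  rewrite ler_wpM2l// ?mulr_ge0 ?exprn_ge0//.
  have u : q * (8 * e) <= 2 * 4 by rewrite ler_pM//; move: e0 e2; lra.
  have : 3 * fixed_C1 * (q * (8 * e)) <= 3 * fixed_C1 * (2 * 4).
    by rewrite ler_wpM2l// mulr_ge0.
  by lra.
have s3 : 3 * N%:R * a * b * (fixed_C1 * q ^+ 2 + fixed_C0 * (8 * e))
    <= 3 * N%:R * a * b * (4 * (fixed_C1 + fixed_C0)).
  rewrite ler_wpM2l ?mulr_ge0//.
  have u1 : fixed_C1 * q ^+ 2 <= fixed_C1 * 4.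
    rewrite ler_wpM2l//; have -> : (4 : R) = 2 ^+ 2 by ring.
    by rewrite lerXn2r ?nnegrE.
  have u2 : fixed_C0 * (8 * e) <= fixed_C0 * 4.
    by rewrite ler_wpM2l//; move: e2; lra.
  by move: u1 u2; lra.
have s4 : N%:R * c * (fixed_C0 * q) <= N%:R * c * (2 * fixed_C0).
  by rewrite ler_wpM2l ?mulr_ge0// mulrC ler_wpM2r.
have s5 : N%:R * a ^+ 3 * q ^+ 3 * C <= k * C by rewrite ler_wpM2r.
by move: s2 s3 s4 s5; lra.
Qed.

End FixedDensityBounds.

(** * The operator [K] and the invertibility of the perturbed operator *)

Section PerturbedOperator.
Variables (R : realType) (h : R -> R -> R) (D : kernel_data h).
Local Notation hh := (kd D).
Local Notation H := (kd_bound D).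
Variables (t e : R) (r r1 r2 : R -> R).
Hypotheses (rp : periodic r 1) (rD : has_deriv r r1) (r1D : has_deriv r1 r2).
Hypothesis r2c : continuous r2.
Variable BQ : branch_sum (Q h t r) 1 (1 + 2 * e) (8 * e) 32.
Implicit Types (f g : R -> R) (b d : R).

Let w g x := r x * A h g x.
Let w1 g x := r1 x * A h g x + r x * A (hh 1) g x.
Let w2 g x := r2 x * A h g x + 2 * r1 x * A (hh 1) g x + r x * A (hh 2) g x.

Lemma coupling_weight_deriv g : continuous g -> periodic g 1 ->
  [/\ periodic (w g) 1, has_deriv (w g) (w1 g), has_deriv (w1 g) (w2 g)
    & continuous (w2 g)].
Proof.
move=> gc gp.
have D0 : has_deriv (A h g) (A (hh 1) g) by rewrite (A_kd0 D); exact: A_deriv.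
have D1 : has_deriv (A (hh 1) g) (A (hh 2) g) by exact: A_deriv.
split.
- by move=> x; rewrite /w rp (A_kd0 D) (A_periodic D).
- exact: has_derivM.
- have := has_derivD (has_derivM r1D D0) (has_derivM rD D1).
  by apply: has_deriv_ext => x; rewrite // /w2; ring.
- have c0 := has_deriv_continuous rD; have c1 := has_deriv_continuous r1D.
  have a0 := has_deriv_continuous D0; have a1 := has_deriv_continuous D1.
  apply: continuous_add; last first.
    by apply: continuous_mul => //; exact: A_continuous.
  apply: continuous_add; apply: continuous_mul => //.
  exact: continuous_scale.
Qed.

Lemma K_branch_deriv1 g : continuous g -> periodic g 1 ->
  K h t r g = branch_deriv1 BQ (w g) (w1 g).
Proof.
move=> gc gp; have [wp wD _ _] := coupling_weight_deriv gc gp.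
by rewrite KE (has_derivE (branch_sum_deriv1 BQ wp wD)).
Qed.

Lemma K_deriv g : continuous g -> periodic g 1 ->
  has_deriv (K h t r g) (branch_deriv2 BQ (w g) (w1 g) (w2 g)).
Proof.
move=> gc gp; have [wp wD w1D _] := coupling_weight_deriv gc gp.
by rewrite K_branch_deriv1//; exact: branch_sum_deriv2.
Qed.

(** The mean vanishes because [K g] is the derivative of a periodic function; it is C^1 because [r]
    is C^2. *)
Lemma K_C1_mean0 g : continuous g -> periodic g 1 -> C1_mean0 (K h t r g).
Proof.
move=> gc gp; have [wp wD w1D w2c] := coupling_weight_deriv gc gp.
have KD := K_deriv gc gp.
have QD := branch_sum_deriv1 BQ wp wD; rewrite -K_branch_deriv1// in QD.
have Qp : periodic (Q h t r (w g)) 1 by exact: bs_periodic BQ _ wp.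
apply: (C1_mean0_intro _ KD).
- exact: has_deriv_periodic QD.
- exact: branch_deriv2_continuous.
- exact: circle_mean_periodic_deriv QD (has_deriv_continuous KD) Qp.
Qed.

Lemma KD f g : continuous f -> periodic f 1 -> continuous g -> periodic g 1 ->
  K h t r (f + g) = K h t r f + K h t r g.
Proof.
move=> fc fp gc gp; have [wfp wfD _ _] := coupling_weight_deriv fc fp.
have [wgp wgD _ _] := coupling_weight_deriv gc gp.
rewrite !KE -[LHS]/(derive1 (Q h t r (w (f + g)))).
have -> : w (f + g) = w f + w g.
  apply/funext => x; rewrite !fctE /w -mulrDr; congr (_ * _).
  by rewrite (A_kd0 D) (AD D (i := 0) isT fc gc).
rewrite (branch_sumD BQ)//.
have QfD := branch_sum_deriv1 BQ wfp wfD; have QgD := branch_sum_deriv1 BQ wgp wgD.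
by rewrite (has_derivE (has_derivD QfD QgD)) (has_derivE QfD) (has_derivE QgD).
Qed.

Lemma KZ c g : continuous g -> periodic g 1 -> K h t r (c *: g) = c *: K h t r g.
Proof.
move=> gc gp; have [wgp wgD _ _] := coupling_weight_deriv gc gp.
rewrite !KE -[LHS]/(derive1 (Q h t r (w (c *: g)))).
have -> : w (c *: g) = c *: w g.
  apply/funext => x; rewrite !fctE /w /GRing.scale/= mulrCA; congr (_ * _).
  by rewrite (A_kd0 D) (AZ D (i := 0) c isT gc).
rewrite (branch_sumZ BQ)//; have QgD := branch_sum_deriv1 BQ wgp wgD.
by rewrite (has_derivE (has_derivZ c QgD)) (has_derivE QgD).
Qed.

Variables (C0 C1 C2 : R).
Hypotheses (e0 : 0 <= e) (e2 : e <= 2^-1).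
Hypotheses (rC0 : forall x, `|r x| <= C0) (rC1 : forall x, `|r1 x| <= C1).
Hypothesis rC2 : forall x, `|r2 x| <= C2.

(** The coefficients 8, 24 and 32 are those of [branch_deriv2_bound] for [Q] at [e = 1/2]; they
    multiply bounds on the second derivative, the first derivative and the values of [r * A_g]. *)
Definition K_bound : R :=
  H * (8 * (C2 + 2 * C1 + C0) + 24 * (C1 + C0) + 32 * C0).

(** All derivatives fall on [h], [r] and the inverse of [Phi], none on [g], so the sup norm of [g]
    suffices. *)
Lemma K_deriv_bound g b : continuous g -> periodic g 1 ->
  (forall x, `|g x| <= b) -> forall x, `|derive1 (K h t r g) x| <= K_bound * b.
Proof.
move=> gc gp gb x; rewrite (has_derivE (K_deriv gc gp)).
have H0 := kd_bound_ge0 D.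
have b0 : 0 <= b by exact: le_trans (normr_ge0 _) (gb 0).
have C00 : 0 <= C0 by exact: le_trans (normr_ge0 _) (rC0 0).
have C10 : 0 <= C1 by exact: le_trans (normr_ge0 _) (rC1 0).
have C20 : 0 <= C2 by exact: le_trans (normr_ge0 _) (rC2 0).
have Ab i y : (i <= 4)%N -> `|A (hh i) g y| <= H * b by move=> i4; exact: A_bound.
have A0b y : `|A h g y| <= H * b by rewrite (A_kd0 D); exact: Ab.
have wb y : `|w g y| <= C0 * (H * b) by rewrite normrM ler_pM.
have w1b y : `|w1 g y| <= (C1 + C0) * (H * b).
  by rewrite mulrDl (le_trans (ler_normD _ _))// !normrM lerD// ler_pM// Ab.
have w2b y : `|w2 g y| <= (C2 + 2 * C1 + C0) * (H * b).
  have v0 : `|r2 y * A h g y| <= C2 * (H * b) by rewrite normrM ler_pM.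
  have v1 : `|2 * r1 y * A (hh 1) g y| <= 2 * C1 * (H * b).
    by rewrite normrM ler_pM ?Ab// normrM normr_nat ler_pM.
  have v2 : `|r y * A (hh 2) g y| <= C0 * (H * b) by rewrite normrM ler_pM ?Ab.
  have -> : (C2 + 2 * C1 + C0) * (H * b) =
    C2 * (H * b) + 2 * C1 * (H * b) + C0 * (H * b) by ring.
  apply: (le_trans (ler_normD _ _)); apply: lerD => //.
  by apply: (le_trans (ler_normD _ _)); apply: lerD.
apply: le_trans (branch_deriv2_bound BQ wb w1b w2b x) _.
rewrite mul1r /K_bound; set q := 1 + 2 * e; set Hb := H * b.
have Hb0 : 0 <= Hb by exact: mulr_ge0.
have q0 : 0 <= q by move: e0; rewrite /q; lra.
have q2 : q <= 2 by move: e2; rewrite /q; lra.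
have u1 : (C2 + 2 * C1 + C0) * Hb * q ^+ 3 <= (C2 + 2 * C1 + C0) * Hb * 8.
  apply: ler_wpM2l; first by rewrite mulr_ge0// !addr_ge0// mulr_ge0.
  have -> : (8 : R) = 2 ^+ 3 by ring.
  by rewrite lerXn2r ?nnegrE.
have u2 : 3 * ((C1 + C0) * Hb) * (q * (8 * e)) <= 3 * ((C1 + C0) * Hb) * 8.
  apply: ler_wpM2l; first by rewrite !mulr_ge0// addr_ge0.
  have -> : (8 : R) = 2 * 4 by ring.
  by rewrite ler_pM// ?mulr_ge0//; move: e2; lra.
have -> : H * (8 * (C2 + 2 * C1 + C0) + 24 * (C1 + C0) + 32 * C0) * b =
  (C2 + 2 * C1 + C0) * Hb * 8 + 3 * ((C1 + C0) * Hb) * 8 + C0 * Hb * 32.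
  by rewrite /Hb; ring.
by rewrite lerD// lerD// -mulrA.
Qed.

Variables (P : (R -> R) -> R -> R) (N : nat) (a b c k : R).
Variable BP : branch_sum P N a b c.
Hypotheses (k1 : k < 1) (tK : `|t| * K_bound <= e).
Hypothesis Pk : N%:R * (a ^+ 2 + b) * (1 + 15 * e) <= k.

Lemma perturbed_transfer_bij :
  set_bij (@C1_mean0 R) (@C1_mean0 R)
    (fun g => g - P (Q h t r g) + t *: P (K h t r g)).
Proof.
pose S g := P (Q h t r g - t *: K h t r g).
have perC g : C1_mean0 g -> continuous g /\ periodic g 1.
  by move=> /C1_mean0P[gp gD _ _]; split => //; exact: has_deriv_continuous gD.
have KX g : C1_mean0 g -> C1_mean0 (K h t r g).
  by move=> /perC[gc gp]; exact: K_C1_mean0.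
have QX g : C1_mean0 g -> C1_mean0 (Q h t r g) by exact: (branch_sum_C1_mean0 BQ).
have QKX g : C1_mean0 g -> C1_mean0 (Q h t r g - t *: K h t r g).
  by move=> gX; apply: C1_mean0B; [exact: QX|exact/C1_mean0Z/KX].
have SE g : C1_mean0 g -> g - S g = g - P (Q h t r g) + t *: P (K h t r g).
  move=> gX; have [_ Kp] := perC _ (KX g gX); have [_ Qp] := perC _ (QX g gX).
  have [_ tKp] := perC _ (C1_mean0Z t (KX g gX)).
  by rewrite /S (branch_sumB BP)// (branch_sumZ BP)// opprB addrA addrAC.
suff [bX inj surj] : set_bij (@C1_mean0 R) (@C1_mean0 R) (fun g => g - S g).
  split.
  - by move=> g gX; rewrite -SE//; exact: bX.
  - move=> f g fI gI fg; apply: (inj f g fI gI).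
    exact: etrans (SE f (set_mem fI)) (etrans fg (esym (SE g (set_mem gI)))).
  - by move=> u /surj[g gX <-]; exists g => //; rewrite -SE.
have a0 : 0 <= a by exact: le_trans (normr_ge0 _) (bs_y1_bound BP 0).
have b0 : 0 <= b by exact: le_trans (normr_ge0 _) (bs_y2_bound BP 0).
have Na0 : 0 <= N%:R * (a ^+ 2 + b) by rewrite mulr_ge0// addr_ge0// exprn_ge0.
have k0 : 0 <= k by apply: le_trans Pk; rewrite mulr_ge0//; move: e0; lra.
apply: (@C1_mean0_contraction_bij _ _ k); first by rewrite k0.
- by move=> g /QKX; exact: (branch_sum_C1_mean0 BP).
- move=> f g fX gX; rewrite /S.
  have [fc fp] := perC _ fX; have [gc gp] := perC _ gX.
  have [_ Ff] := perC _ (QKX _ fX); have [_ Fg] := perC _ (QKX _ gX).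
  have [Ngc Ngp] := perC _ (C1_mean0Z (-1) gX).
  rewrite -(branch_sumB BP)//; congr P.
  rewrite (branch_sumB BQ)// -[in K h t r (f - g)]scaleN1r KD// KZ// scaleN1r.
  by rewrite scalerBr !opprB addrACA [RHS]addrACA; congr (_ + _); rewrite addrC.
- move=> g d gX gd x; have [gc gp] := perC _ gX.
  have d0 : 0 <= d by exact: le_trans (normr_ge0 _) (gd 0).
  (* Of the factor [1 + 15 * e], [Q] accounts for [1 + 14 * e] and [t *: K] for [e]. *)
  have QKd y : `|derive1 (Q h t r g - t *: K h t r g) y| <= (1 + 15 * e) * d.
    have [_ QD _ _] := (C1_mean0P _).1 (QX _ gX).
    have [_ KD _ _] := (C1_mean0P _).1 (KX _ gX).
    rewrite (has_derivE (has_derivB QD (has_derivZ t KD))).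
    apply: (le_trans (ler_normB _ _)).
    have h1 := branch_sum_contraction BQ gX gd y.
    have h2 : `|t * derive1 (K h t r g) y| <= e * d.
      rewrite normrM; apply: (@le_trans _ _ (`|t| * (K_bound * d))).
        by rewrite ler_wpM2l//; apply: K_deriv_bound => //; exact: C1_mean0_bound.
      by rewrite mulrA ler_wpM2r.
    have h3 : 1 * ((1 + 2 * e) ^+ 2 + 8 * e) * d <= (1 + 14 * e) * d.
      by rewrite ler_wpM2r// mul1r expr2; move: e0 e2; nra.
    by move: h1 h2 h3; lra.
  apply: le_trans (branch_sum_contraction BP (QKX _ gX) QKd x) _.
  by rewrite mulrA ler_wpM2r.
Qed.

End PerturbedOperator.

(** * Derivatives in the parameter *)

Section UniformDerivative.
Variable R : realType.
Implicit Types (U : R -> R -> R) (V z : R -> R) (t x y : R).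

(** Differentiability of the curve [U] at [t] in the sup norm. Uniformity in [x] is what allows
    evaluation at a point that moves with [s]. *)
Definition unif_deriv U t V : Prop := forall e, 0 < e ->
  \forall s \near t, forall x, `|U s x - U t x - (s - t) * V x| <= e * `|s - t|.

Lemma unif_deriv_pointwise U t V x :
  unif_deriv U t V -> is_derive t (1 : R) (U ^~ x) (V x).
Proof.
move=> UD; apply/is_derive_epsP => e /UD; apply: filterS => s /(_ x).
by rewrite [V x * _]mulrC.
Qed.

Lemma unif_deriv_addl U t V c :
  unif_deriv U t V -> unif_deriv (fun s x => c x + U s x) t V.
Proof.
move=> UD e /UD; apply: filterS => s Us x.
by have := Us x; congr (`|_| <= _); ring.
Qed.

Lemma unif_deriv_scale U t V b : (forall x, `|V x| <= b) ->
  unif_deriv U t V -> unif_deriv (fun s x => s * U s x) t (fun x => U t x + t * V x).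
Proof.
move=> Vb UD e e0; have b0 : 0 <= b by exact: le_trans (normr_ge0 _) (Vb 0).
have d0 : 0 < e / 2 / (`|t| + 1) by rewrite !divr_gt0// ltr_wpDl.
have d1 : 0 < e / 2 / (b + 1) by rewrite !divr_gt0// ltr_wpDl.
near=> s => x.
have st1 : `|s - t| <= 1 by near: s; exact: near_dist_le.
have st2 : `|s - t| <= e / 2 / (b + 1) by near: s; exact: near_dist_le.
have UU : `|U s x - U t x - (s - t) * V x| <= e / 2 / (`|t| + 1) * `|s - t|.
  by move: x; near: s; exact: UD.
have -> : s * U s x - t * U t x - (s - t) * (U t x + t * V x) =
  s * (U s x - U t x - (s - t) * V x) + (s - t) * V x * (s - t) by ring.
have h1 : `|s * (U s x - U t x - (s - t) * V x)| <= e / 2 * `|s - t|.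
  have ts : `|s| <= `|t| + 1.
    have -> : s = t + (s - t) by ring.
    by apply: (le_trans (ler_normD _ _)); rewrite lerD2l.
  rewrite normrM; apply: (le_trans (ler_pM _ _ ts UU)) => //.
  by rewrite mulrA [X in X * _]mulrC divfK// gt_eqF// ltr_wpDl.
have h2 : `|(s - t) * V x * (s - t)| <= e / 2 * `|s - t|.
  rewrite normrM ler_wpM2r// normrM; apply: (le_trans (ler_pM _ _ st2 (Vb x))) => //.
  apply: (@le_trans _ _ (e / 2 / (b + 1) * (b + 1))).
    by rewrite ler_wpM2l ?lerDl// ltW.
  by rewrite divfK// gt_eqF// ltr_wpDl.
by apply: (le_trans (ler_normD _ _)); move: h1 h2; lra.
Unshelve. all: by end_near. Qed.

(** The increment is [(s - t) * V (z s)] up to a uniform error. Continuity of [z] suffices, as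
    required in [moving_inverse], where differentiability of [z] is the goal. *)
Lemma moving_diff U t V z : unif_deriv U t V -> {for z t, continuous V} ->
  {for t, continuous z} ->
  is_derive t (1 : R) (fun s => U s (z s) - U t (z s)) (V (z t)).
Proof.
move=> UD Vc zc; apply/is_derive_epsP => e e0.
have e2 : 0 < e / 2 by rewrite divr_gt0.
have /cvgrPdist_le/(_ _ e2) Vz : V (z s) @[s --> t] --> V (z t).
  exact: continuous_comp zc Vc.
apply: filterS2 (UD _ e2) Vz => s /(_ (z s)) h1 h2.
have -> : U s (z s) - U t (z s) - (U t (z t) - U t (z t)) - V (z t) * (s - t) =
  (U s (z s) - U t (z s) - (s - t) * V (z s)) - (V (z t) - V (z s)) * (s - t) by ring.
apply: (le_trans (ler_normB _ _)); rewrite [X in _ + X]normrM.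
have : `|V (z t) - V (z s)| * `|s - t| <= e / 2 * `|s - t| by rewrite ler_wpM2r.
by move: h1; lra.
Qed.

Lemma moving_eval U t V z (u1 z1 : R) : unif_deriv U t V ->
  {for z t, continuous V} -> is_derive (z t) (1 : R) (U t) u1 ->
  is_derive t (1 : R) z z1 ->
  is_derive t (1 : R) (fun s => U s (z s)) (V (z t) + u1 * z1).
Proof.
move=> UD Vc Uz zD; have D1 := moving_diff UD Vc (is_derive_continuous zD).
have D2 : is_derive t (1 : R) (fun s => U t (z s)) (u1 * z1) by exact: is_derive1_comp.
have := is_deriveD D1 D2; apply: near_eq_is_derive.
by apply: filterE => s; rewrite !fctE subrK.
Qed.

(* No second derivatives are needed: z s = g (U t (z s)), and U t (z s) differs
   from the constant y by the increment treated in moving_diff. *)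
Lemma moving_inverse U t V z (g : R -> R) (y g1 b : R) : unif_deriv U t V ->
  {for z t, continuous V} -> (forall x, `|V x| <= b) ->
  (\forall s \near t, U s (z s) = y) -> cancel (U t) g ->
  is_derive y (1 : R) g g1 ->
  is_derive t (1 : R) z (g1 * - V (z t)).
Proof.
move=> UD Vc Vb Uz Ug gD.
have zE s : z s = g (U t (z s)) by rewrite Ug.
have Uty : U t (z t) = y by exact: (nbhs_singleton Uz).
(* Continuity of [z] has to come first. The global bound on [V] makes [U s - U t] of order [|s - t|]
   even at [z s], which is not yet known to stay near [z t]. *)
have uc : U t (z s) @[s --> t] --> y.
  apply/cvgrPdist_le => e e0.
  have b0 : 0 <= b by exact: le_trans (normr_ge0 _) (Vb 0).
  have d0 : 0 < e / (1 + b) by rewrite divr_gt0// ltr_pwDl.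
  apply: filterS3 (UD 1 ltr01) Uz (near_dist_le t d0) => s /(_ (z s)) h1 Us st.
  have h2 : `|(s - t) * V (z s)| <= b * `|s - t| by rewrite normrM mulrC ler_wpM2r.
  have h3 : (1 + b) * `|s - t| <= e by rewrite mulrC -ler_pdivlMr// ltr_pwDl.
  rewrite -Us; have -> : U s (z s) - U t (z s) =
    (U s (z s) - U t (z s) - (s - t) * V (z s)) + (s - t) * V (z s) by ring.
  by apply: (le_trans (ler_normD _ _)); move: h1 h2 h3; lra.
have zc : {for t, continuous z}.
  rewrite (funext zE) /prop_for /continuous_at /=.
  by rewrite Uty; exact: continuous_cvg (is_derive_continuous gD) uc.
have uD : is_derive t (1 : R) (fun s => U t (z s)) (- V (z t)).
  have D1 := moving_diff UD Vc zc.
  have := is_deriveB (is_derive_cst y t 1) D1; rewrite sub0r.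
  apply: near_eq_is_derive; apply: filterS Uz => s Us.
  by rewrite !fctE Us opprB addrC subrK.
rewrite -Uty in gD.
have := is_derive1_comp gD uD; apply: near_eq_is_derive.
by apply: filterE => s /=; rewrite -zE.
Qed.

End UniformDerivative.

(** * Differentiating the fixed point equation in the parameter *)

Section ParameterDerivative.
Variables (R : realType) (h : R -> R -> R) (D : kernel_data h).
Local Notation hh := (kd D).
Local Notation H := (kd_bound D).
Implicit Types (e b x y : R).

Lemma unif_deriv_A i (rho : R -> R -> R) (t : R) (v : R -> R) : (i <= 4)%N ->
  (\forall s \near t, continuous (rho s)) -> continuous v ->
  unif_deriv rho t v ->
  unif_deriv (fun s => A (hh i) (rho s)) t (A (hh i) v).
Proof.
move=> i4 rc vc rD e e0; have H0 := kd_bound_ge0 D.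
have H1 : 0 < H + 1 by rewrite ltr_wpDl.
have tc : continuous (rho t) := nbhs_singleton rc.
have d0 : 0 < e / (H + 1) by rewrite divr_gt0.
apply: filterS2 (rD _ d0) rc => s rs sc x.
pose f := fun z => rho s z - rho t z - (s - t) * v z.
have tc' : continuous (fun z => -1 * rho t z) by exact: continuous_scale.
have vc' : continuous (fun z => - (s - t) * v z) by exact: continuous_scale.
have stc : continuous (fun z => rho s z + -1 * rho t z) by exact: continuous_add.
have fE : f = fun z => rho s z + -1 * rho t z + - (s - t) * v z.
  by apply/funext => z; rewrite /f; ring.
have fc : continuous f by rewrite fE; exact: continuous_add.
have -> : A (hh i) (rho s) x - A (hh i) (rho t) x - (s - t) * A (hh i) v x =
    A (hh i) f x.
  by rewrite fE !AD// !AZ//; ring.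
apply: le_trans (A_bound D i4 fc rs x) _.
rewrite mulrA ler_wpM2r// mulrA ler_pdivrMr// [leLHS]mulrC.
by rewrite ler_wpM2l ?(ltW e0)// lerDl.
Qed.

Variables (rho : R -> R -> R) (t : R) (v r1 : R -> R).
Local Notation r := (rho t).
Hypothesis rhoP : \forall s \near t,
  [/\ continuous (rho s), periodic (rho s) 1 & circle_diffeo (Phi h s (rho s))].
Hypotheses (rD : has_deriv r r1) (vc : continuous v) (vp : periodic v 1).
Hypothesis rhoD : unif_deriv rho t v.

(** The derivative of [s * rho s] at [s = t]; the velocity of [Phi h s (rho s)] is therefore
    [A h g]. *)
Let g : R -> R := r + t *: v.

Let rc : continuous r. Proof. exact: has_deriv_continuous rD. Qed.

Let rp : periodic r 1. Proof. by case: (nbhs_singleton rhoP). Qed.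

Let gc : continuous g.
Proof. by apply: continuous_add => //; exact: continuous_scale. Qed.

Let gp : periodic g 1.
Proof. by move=> x; rewrite /g !fctE rp vp. Qed.

Let AgE i x : (i <= 4)%N -> A (hh i) r x + t * A (hh i) v x = A (hh i) g x.
Proof.
move=> i4; rewrite -[RHS]/(A (hh i) (fun z => r z + t * v z) x).
by rewrite AD ?AZ//; exact: continuous_scale.
Qed.

Let unif_scale_A i : (i < 4)%N ->
  unif_deriv (fun s x => s * A (hh i) (rho s) x) t (A (hh i) g).
Proof.
move=> i4; have i4' := ltnW i4.
rewrite (_ : A (hh i) g = fun x => A (hh i) r x + t * A (hh i) v x); last first.
  by apply/funext => x; rewrite AgE.
have [b vb] := continuous_periodic_bounded vp vc.
apply: (unif_deriv_scale (A_bound D i4' vc vb)).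
by apply: unif_deriv_A => //; apply: filterS rhoP => s [].
Qed.

(** With [z] the moving preimage of [y], the function is [rho s (z s) / Phi_s' (z s)]. The change of
    [rho] at a fixed point gives [Q v]; the velocity [- A_g / Phi'] of [z] and the change of the
    denominator combine into [- K g]. *)
Lemma Q_parameter_deriv y :
  is_derive t (1 : R) (fun s => Q h s (rho s) (rho s) y)
    ((Q h t r v - K h t r g) y).
Proof.
have [_ _ diff] := nbhs_singleton rhoP.
have [PK KP] := Phi_invK diff.
have PD := Phi_deriv D t rc rp.
have P1D : has_deriv (Phi1 D t r) (fun x => t * A (hh 2) r x).
  have := has_derivD (has_deriv_cst 1) (has_derivZ t (A_deriv D (i := 1) isT rc rp)).
  by apply: has_deriv_ext => x //; rewrite add0r.
have P1N0 x : Phi1 D t r x != 0.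
  by rewrite -(has_derivE PD); case: diff => _ _ _ /(_ x); exact: lt0r_neq0.
have invD := inverse_deriv PD P1N0 PK KP.
set p := Phi_inv h t r y.
have [b0 gb] := continuous_periodic_bounded gp gc.
have A0D : has_deriv (A (hh 0) g) (A (hh 1) g) by exact: A_deriv.
have PhiU : unif_deriv (fun s => Phi h s (rho s)) t (A (hh 0) g).
  by rewrite /Phi (A_kd0 D); apply: unif_deriv_addl; exact: unif_scale_A.
have Phi1U : unif_deriv (fun s => Phi1 D s (rho s)) t (A (hh 1) g).
  exact: (@unif_deriv_addl _ _ _ _ (fun=> 1)) (unif_scale_A (i := 1) isT).
have zD : is_derive t (1 : R) (fun s => Phi_inv h s (rho s) y)
    ((Phi1 D t r p)^-1 * - A (hh 0) g p).
  apply: (moving_inverse (z := fun s => Phi_inv h s (rho s) y) PhiU _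
    (A_bound D (i := 0) isT gc gb) _ PK (invD y)).
    exact: (has_deriv_continuous A0D).
  apply: filterS rhoP => s [_ _ diffs].
  by have [_ ->] := Phi_invK diffs.
set z' := _ * - _ in zD.
have vcp : {for p, continuous v} by exact: vc.
have A1cp : {for p, continuous (A (hh 1) g)} by exact: A_continuous.
have numD := moving_eval (z := fun s => Phi_inv h s (rho s) y) rhoD vcp (rD p) zD.
have denD := moving_eval (z := fun s => Phi_inv h s (rho s) y) Phi1U A1cp (P1D p) zD.
have invdenD := is_derive_inv
  (f := fun s => Phi1 D s (rho s) (Phi_inv h s (rho s) y)) (P1N0 p) denD.
have := is_derive_mul numD invdenD.
have QsE : \forall s \near t, rho s (Phi_inv h s (rho s) y) *
    (Phi1 D s (rho s) (Phi_inv h s (rho s) y))^-1 = Q h s (rho s) (rho s) y.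
  by apply: filterS rhoP => s [sc sp _]; rewrite (QE D).
move=> /(near_eq_is_derive QsE); rewrite -/p => QD.
apply: is_derive_eq; rewrite !fctE (QE D)// /wcomp -/p.
have wD : has_deriv (fun x => r x * A h g x)
    (fun x => r1 x * A h g x + r x * A (hh 1) g x).
  by apply: has_derivM => //; rewrite (A_kd0 D).
(* [K] is expanded at [y] in the same quantities at [p], so that the comparison becomes a rational
   identity. *)
have KyE : K h t r g y =
    (r1 p * A h g p + r p * A (hh 1) g p) * (Phi1 D t r p)^-1 * (Phi1 D t r p)^-1 +
    r p * A h g p * - (t * A (hh 2) r p * (Phi1 D t r p)^-1 / Phi1 D t r p ^+ 2).
  rewrite KE (QE D)//.
  have d1 := has_deriv_comp wD invD y.
  have d2 := is_derive_inv (f := fun x => Phi1 D t r (Phi_inv h t r x)) (P1N0 p)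
    (has_deriv_comp P1D invD y).
  have d3 := is_derive_mul d1 d2.
  by rewrite derive1E; case: d3 => _ ->.
rewrite KyE /z' (A_kd0 D); field.
exact: P1N0.
Qed.

(** At a given [x], [P] is a finite sum over branches that do not depend on [s], so the derivative
    in [s] passes through it and reduces to [Q_parameter_deriv] at the points of these branches. *)
Lemma fixed_density_derivative (P : (R -> R) -> R -> R) N a b c
    (BP : branch_sum P N a b c) : C1_mean0 v -> C1_mean0 (K h t r g) ->
  periodic (Q h t r v) 1 ->
  (\forall s \near t, P (Q h s (rho s) (rho s)) = rho s) ->
  v = P (Q h t r v - K h t r g).
Proof.
move=> vX KX Qvp fix_; apply/funext => x.
have [Kp _ _ _] := (C1_mean0P _).1 KX.
have d1 := unif_deriv_pointwise x rhoD.
have Pp : periodic (Q h t r v - K h t r g) 1.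
  by move=> z; rewrite !fctE Qvp Kp.
have E : \forall s \near t, shift_sum (bs_s BP) N
    (wcomp (bs_y BP) (bs_y1 BP) (Q h s (rho s) (rho s))) x = rho s x.
  apply: filterS2 fix_ rhoP => s Es [sc sp diff].
  have Qsp : periodic (Q h s (rho s) (rho s)) 1.
    move=> z; have [PK KP] := Phi_invK diff; rewrite (QE D)// /wcomp.
    have -> : Phi_inv h s (rho s) (z + 1) = Phi_inv h s (rho s) z + 1.
      by rewrite -{1}[z]KP; have [Ps _ _ _] := diff; rewrite -Ps PK.
    by rewrite sp /Phi1 (A_periodic D).
  have := congr1 (@^~ x) Es; rewrite (@bs_E _ _ _ _ _ _ BP _ Qsp); exact.
have d2 : is_derive t (1 : R) (fun s => shift_sum (bs_s BP) N
    (wcomp (bs_y BP) (bs_y1 BP) (Q h s (rho s) (rho s))) x)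
    (P (Q h t r v - K h t r g) x).
  rewrite (bs_E BP)// /shift_sum.
  have sD : is_derive t (1 : R) (fun s => \sum_(j < N)
      wcomp (bs_y BP) (bs_y1 BP) (Q h s (rho s) (rho s)) (x + j%:R))
      (\sum_(j < N) wcomp (bs_y BP) (bs_y1 BP) (Q h t r v - K h t r g) (x + j%:R)).
    rewrite -fct_sumE; apply: is_derive_sum => j.
    have := is_derive_mul (Q_parameter_deriv (bs_y BP (x + j%:R)))
      (is_derive_cst (bs_y1 BP (x + j%:R)) t 1).
    rewrite mulr0 addr0; exact.
  have := is_derive_mul (is_derive_cst (bs_s BP) t 1) sD.
  by rewrite mul0r add0r.
have d3 := near_eq_is_derive E d2.
by rewrite -(@derive_val _ _ _ _ _ _ _ d1) (@derive_val _ _ _ _ _ _ _ d3).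
Qed.

End ParameterDerivative.

(** * Curves of densities, and the uncoupled case [t = 0] *)

Section Curves.
Variable R : realType.
Implicit Types (rho : R -> R -> R) (v : R -> R) (e t : R).

Lemma C0norm_ge (g : R -> R) x : ((`|g x|)%:E <= C0norm g)%E.
Proof. by apply: ereal_sup_ubound; exists x. Qed.

Lemma C0norm_le_Cknorm1 (g : R -> R) : (C0norm g <= Cknorm 1 g)%E.
Proof.
rewrite /Cknorm big_ord_recl big_ord1 leeDl//.
by apply: (le_trans _ (C0norm_ge _ 0)); rewrite lee_fin.
Qed.

Lemma within_itv_subset e e' : e' <= e ->
  [set` `[- e', e']] `<=` [set` `[- e, e] : interval R].
Proof. by move=> ee x /=; rewrite !in_itv/= => /andP[? ?]; apply/andP; split; lra. Qed.

Lemma C1_deriv_sub e e' rho t v : e' <= e ->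
  C1_deriv e rho t v -> C1_deriv e' rho t v.
Proof.
move=> ee [vS vD]; split=> //; apply: cvg_trans vD; apply: cvg_app.
exact: within_subset (within_itv_subset ee).
Qed.

Lemma C1_curve_sub e e' rho : e' <= e -> C1_curve e rho -> C1_curve e' rho.
Proof.
move=> ee [rS [drho drhoP]].
have sub t : t \in `[- e', e'] -> t \in `[- e, e] by exact: within_itv_subset.
split=> [t /sub/rS//|]; exists drho => t /sub/drhoP[rD dc].
split; first exact: C1_deriv_sub rD.
apply: cvg_trans dc; apply: cvg_app.
exact: within_subset (within_itv_subset ee).
Qed.

(** At an interior point the limit within the interval is two-sided, and the C^1 norm dominates the
    sup norm. *)
Lemma C1_deriv_unif e rho t v : t \in `]- e, e[ -> C1_deriv e rho t v ->
  unif_deriv rho t v.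
Proof.
move=> te [_ vD] d d0.
have nb : nbhs (0%:E : \bar R) [set y | (y < d%:E)%E].
  by apply: open_nbhs_nbhs; split; [exact: open_ereal_lt_ereal|rewrite /= lte_fin].
have itv : \forall s \near t, s \in `[- e, e].
  apply: filterS (near_in_itvoo te) => s; rewrite !in_itv/=.
  by move=> /andP[/ltW -> /ltW ->].
have : \forall s \near within [set` `[- e, e]] t^',
    (Cknorm 1 (fun x => (rho s x - rho t x) / (s - t) - v x)%R < d%:E)%E.
  exact: vD _ nb.
rewrite !near_withinE; apply: filterS2 itv => s se H x.
have [->|st] := eqVneq s t; first by rewrite !subrr mul0r subrr !normr0 mulr0.
have st0 : s - t != 0 by rewrite subr_eq0.
move: (H st se).
move=> /(le_lt_trans (C0norm_le_Cknorm1 _))/(le_lt_trans (C0norm_ge _ x)).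
rewrite lte_fin => /ltW qd.
have -> : rho s x - rho t x - (s - t) * v x =
  ((rho s x - rho t x) / (s - t) - v x) * (s - t) by field.
by rewrite normrM ler_wpM2r.
Qed.

(** The mean is linear and bounded for the sup norm, so the mean of [v] is the derivative of the
    constant mass 1. *)
Lemma unif_deriv_mean0 rho t v : (\forall s \near t, continuous (rho s)) ->
  (\forall s \near t, circle_mean (rho s) = 1) -> continuous v ->
  unif_deriv rho t v -> circle_mean v = 0.
Proof.
move=> rc r1 vc rD.
have tc : continuous (rho t) := nbhs_singleton rc.
have D1 : is_derive t (1 : R) (fun s => circle_mean (rho s)) (circle_mean v).
  apply/is_derive_epsP => e e0; apply: filterS2 rc (rD e e0) => s sc H.
  have c1 : continuous (fun x => rho s x - rho t x).
    by apply: continuous_add => //; exact: continuous_opp.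
  have c2 : continuous (fun x => (s - t) * v x) by exact: continuous_scale.
  rewrite mulrC -circle_meanB// -circle_meanZ// -circle_meanB//.
  by apply: circle_mean_bounded => //; apply: continuous_add => //; exact: continuous_opp.
have r1' : \forall s \near t, 1 = circle_mean (rho s) by apply: filterS r1 => s ->.
have D2 := near_eq_is_derive r1' (is_derive_cst (1 : R) t 1).
by rewrite -(@derive_val _ _ _ _ _ _ _ D1) (@derive_val _ _ _ _ _ _ _ D2).
Qed.

Lemma inv_onE (X : set (R -> R)) (T : (R -> R) -> R -> R) g :
  set_bij X X T -> X g -> inv_on X T (T g) = g.
Proof. by move=> [_ inj _] gX; apply: pinvKV => //; rewrite inE. Qed.

Lemma Phi_inv0 (h : R -> R -> R) (r : R -> R) : Phi_inv h 0 r = id.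
Proof.
have E : Phi h 0 r = id by apply/funext => x; rewrite /Phi mul0r addr0.
apply/funext => x; rewrite /Phi_inv E.
by apply: (@pinvKV _ _ _ _ id); rewrite ?inE.
Qed.

Lemma derive1_Phi0 (h : R -> R -> R) (r : R -> R) : derive1 (Phi h 0 r) = cst 1.
Proof.
have -> : Phi h 0 r = fun x => x by apply/funext => x; rewrite /Phi mul0r addr0.
exact: (has_derivE (@has_deriv_id R)).
Qed.

Lemma Q0 (h : R -> R -> R) (r phi : R -> R) : Q h 0 r phi = phi.
Proof.
by rewrite /Q Phi_inv0 derive1_Phi0; apply/funext => x /=; rewrite divr1.
Qed.

Lemma K0 (h : R -> R -> R) (r g : R -> R) : K h 0 r g = derive1 (r * A h g).
Proof. by rewrite KE Q0. Qed.

End Curves.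

(** * Choice of the smallness constants and the response formula *)

Theorem proposition1p4 (R : realType)
  (N : nat) (omega : R) (F : R -> R) (h : R -> R -> R)
  (homega : 1 < omega)
  (FC5 : Ck 5 F)
  (Fcov : covering_lift N F)
  (Fexp : forall x, omega < `|derive1 F x|)
  (Fdist : N%:R * (sup [set `|derive1n 2 F x| | x in [set: R]] / omega ^+ 3
                   + (omega ^+ 2)^-1) < 1)
  (hC5 : CkT2 5 h)
  (e0 : R) (he0 : 0 < e0)
  (Phidiffeo : forall t, t \in `[- e0, e0] ->
     forall psi, density psi -> circle_diffeo (Phi h t psi))
  (rho : R -> R -> R)
  (rhofix : forall t, t \in `[- e0, e0] -> unique_fixed_density F h t (rho t))
  (e2 : R) (he2 : 0 < e2) (e2le : e2 <= e0)
  (e2inv : invariant_curves F h e2)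
  (rhoC3 : forall t, t \in `[- e2, e2] -> CkS1 3 (rho t))
  (rhoC1 : C1_curve e2 rho) :
  exists e3 : R, [/\ 0 < e3, e3 <= e2, C1_curve e3 rho,
    let P := transfer F in
    let T := fun g : R -> R => g - P g in
    let b := P (derive1 (rho 0 * A h (rho 0))) in
    [/\ set_bij (@C1_mean0 R) (@C1_mean0 R) T, C1_mean0 b
      & C1_deriv e3 rho 0 (- inv_on (@C1_mean0 R) T b)]
  & forall that : R, that \in `]- e3, e3[ ->
    let P := transfer F in
    let Pthat := Pt F h that (rho that) in
    let Kthat := K h that (rho that) in
    let T := fun g : R -> R => g - Pthat g + that *: P (Kthat g) in
    let b := P (Kthat (rho that)) in
    [/\ set_bij (@C1_mean0 R) (@C1_mean0 R) T, C1_mean0 b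
      & C1_deriv e3 rho that (- inv_on (@C1_mean0 R) T b)]].
Proof.
have w0 : 0 < omega by rewrite (lt_trans ltr01).
have [c3 [BP]] := expanding_branch_sum homega FC5 Fcov Fexp.
have [D] := CkT2_kernel_data hC5.
set a := omega^-1 in BP; set b2 := sup _ / _ in BP Fdist.
set kappa := N%:R * (a ^+ 2 + b2).
have kappa1 : kappa < 1 by rewrite /kappa addrC /a exprVn.
have kappa0 : 0 <= kappa.
  rewrite mulr_ge0// addr_ge0//; first by rewrite exprn_ge0// invr_ge0 ltW.
  exact: le_trans (normr_ge0 _) (bs_y2_bound BP 0).
(* [k] is halfway between [kappa] and 1, and [15 * e = (1 - kappa) / 2], so
   [kappa * (1 + 15 * e) <= k] because [kappa <= 1]. *)
pose e := (1 - kappa) / 30; pose k := (1 + kappa) / 2.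
have e_gt0 : 0 < e by rewrite /e; lra.
have e_le : e <= 2^-1 by rewrite /e; lra.
have k1 : k < 1 by rewrite /k; lra.
have kappa_k : kappa * (1 + 15 * e) <= k by rewrite /k /e; nra.
have kappa_k' : kappa * (1 + 14 * e) <= k.
  by apply: le_trans kappa_k; rewrite ler_wpM2l// lerD2l ler_wpM2r ?(ltW e_gt0)// ler_nat.
(* These bounds hold for every small [t] but do not depend on [t], so [e3] can be chosen from them
   without circularity. *)
pose C0 := fixed_C0 k; pose C1 := fixed_C1 k; pose C2 := fixed_C2 N a b2 c3 k.
pose E := K_bound D C0 C1 C2.
have H0 := kd_bound_ge0 D; set H := kd_bound D in H0.
(* A single denominator makes both [|t| * H] and [|t| * E] at most [e]; the 1 keeps it positive. *)
pose e3 := Num.min e2 (e / (H + `|E| + 1)).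
have den_gt0 : 0 < H + `|E| + 1 by rewrite ltr_wpDl// addr_ge0.
have e3_gt0 : 0 < e3 by rewrite lt_min he2 divr_gt0.
have e3e2 : e3 <= e2 by rewrite ge_min lexx.
have itv3 t : t \in `]- e3, e3[ -> t \in `]- e2, e2[.
  by rewrite !in_itv/= => /andP[? ?]; apply/andP; split; lra.
have itv2 t : t \in `]- e2, e2[ -> t \in `[- e2, e2].
  by rewrite !in_itv/= => /andP[? ?]; apply/andP; split; lra.
have itv0 t : t \in `[- e2, e2] -> t \in `[- e0, e0].
  by rewrite !in_itv/= => /andP[? ?]; apply/andP; split; lra.
have small t : t \in `]- e3, e3[ -> `|t| * H <= e /\ `|t| * E <= e.
  rewrite in_itv/= -ltr_norml => te3.
  have tden : `|t| * (H + `|E| + 1) <= e.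
    by rewrite -ler_pdivlMr// (le_trans (ltW te3))// ge_min lexx orbT.
  split; apply: le_trans tden; rewrite ler_wpM2l//.
    by rewrite -addrA lerDl addr_ge0.
  by have := ler_norm E; lra.
have main t : t \in `]- e3, e3[ ->
    let T := fun g : R -> R => g - transfer F (Q h t (rho t) g) +
      t *: transfer F (K h t (rho t) g) in
    let b := transfer F (K h t (rho t) (rho t)) in
    [/\ set_bij (@C1_mean0 R) (@C1_mean0 R) T, C1_mean0 b
      & C1_deriv e3 rho t (- inv_on (@C1_mean0 R) T b)].
  move=> te3; have [tH tE] := small t te3; have te2 := itv3 t te3.
  move=> T b.
  have near_e2 : \forall s \near t, s \in `[- e2, e2].
    by apply: filterS (near_in_itvoo te2) => s /itv2.
  have rhoP s : s \in `[- e2, e2] ->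
      [/\ continuous (rho s), periodic (rho s) 1 & circle_diffeo (Phi h s (rho s))].
    move=> se2; have [rp /Ck_deriv rDs] := rhoC3 _ se2.
    have [rd _ _ _ _] := rhofix _ (itv0 _ se2).
    split => //; last exact: Phidiffeo _ (itv0 _ se2) _ rd.
    exact: has_deriv_continuous (rDs 0%N isT).
  have [rp /Ck_deriv rDs] := rhoC3 _ (itv2 _ te2).
  have rD := rDs 0%N isT; have r1D := rDs 1%N isT; have r2D := rDs 2%N isT.
  rewrite derive1n0 in rD; have r2c := has_deriv_continuous r2D.
  have [rc _ diff] := rhoP _ (itv2 _ te2).
  have [[_ _ r_ge0 _ r_mean] _ _ Lr _] := rhofix _ (itv0 _ (itv2 _ te2)).
  have [BQ] := coupling_branch_sum rc rp r_ge0 r_mean diff tH e_le.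
  have [B0 B1 B2] := fixed_density_bounds BP BQ (ltW e_gt0) e_le k1 kappa_k'
    rp rD r1D r2c r_mean Lr.
  have bij := perturbed_transfer_bij rp rD r1D r2c BQ (ltW e_gt0) e_le B0 B1 B2 BP
    k1 tE kappa_k.
  have KX (g : R -> R) : continuous g -> periodic g 1 -> C1_mean0 (K h t (rho t) g).
    exact: K_C1_mean0 rp rD r1D r2c BQ g.
  have bX : C1_mean0 b by apply: (branch_sum_C1_mean0 BP); exact: KX.
  have [_ [drho /(_ _ (itv2 _ te2))[vD _]]] := rhoC1.
  set v := drho t in vD.
  have [vp [v' vD' _]] := (CkS1_1P _).1 vD.1.
  have vc := has_deriv_continuous vD'.
  have vU := C1_deriv_unif te2 vD.
  have vX : C1_mean0 v.
    split; first exact: vD.1.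
    apply: (unif_deriv_mean0 _ _ vc vU).
      by apply: filterS near_e2 => s /rhoP[].
    by apply: filterS near_e2 => s /itv0/rhofix[[]].
  have rhoP' : \forall s \near t,
      [/\ continuous (rho s), periodic (rho s) 1 & circle_diffeo (Phi h s (rho s))].
    by apply: filterS near_e2 => s /rhoP.
  have tvc : continuous (t *: v) by exact: continuous_scale.
  have tvp : periodic (t *: v) 1 by move=> x; rewrite !fctE vp.
  have gX : C1_mean0 (K h t (rho t) (rho t + t *: v)).
    apply: KX; first exact: continuous_add.
    by move=> x; rewrite !fctE rp vp.
  have QvX := branch_sum_C1_mean0 BQ vX.
  have [Qvp _ _ _] := (C1_mean0P _).1 QvX.
  have fixP : \forall s \near t, transfer F (Q h s (rho s) (rho s)) = rho s.
    by apply: filterS near_e2 => s /itv0/rhofix[].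
  have vE := fixed_density_derivative D rhoP' rD vc vp vU BP vX gX Qvp fixP.
  have KrX : C1_mean0 (K h t (rho t) (rho t)) by exact: KX.
  have KvX : C1_mean0 (K h t (rho t) v) by exact: KX.
  have [Krp _ _ _] := (C1_mean0P _).1 KrX.
  have [Kvp _ _ _] := (C1_mean0P _).1 KvX.
  have [tKvp _ _ _] := (C1_mean0P _).1 (C1_mean0Z t KvX).
  have [Kgp _ _ _] := (C1_mean0P _).1 gX.
  have Kg : K h t (rho t) (rho t + t *: v) =
      K h t (rho t) (rho t) + t *: K h t (rho t) v.
    by rewrite (KD D rp rD r1D r2c BQ)// (KZ D rp rD r1D r2c BQ).
  have vE' : v = transfer F (Q h t (rho t) v) -
      (b + t *: transfer F (K h t (rho t) v)).
    rewrite {1}vE (branch_sumB BP)//; congr (_ - _).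
    by rewrite Kg (branch_sumD BP)// (branch_sumZ BP).
  (* Stated for [- v], so that [inv_onE] gives the preimage of [b] directly, without linearity of
     the inverse. *)
  have TvE : T (- v) = b.
    rewrite /T -scaleN1r (branch_sumZ BQ)// (KZ D rp rD r1D r2c BQ)//.
    rewrite !(branch_sumZ BP)// !scaleN1r {1}vE' scalerN; apply/funext => x.
    by rewrite !fctE; ring.
  have NvX : C1_mean0 (- v) by rewrite -scaleN1r; exact: C1_mean0Z.
  split => //; rewrite -TvE (inv_onE bij NvX) opprK.
  exact: C1_deriv_sub e3e2 vD.
exists e3; split => //; [exact: C1_curve_sub e3e2 rhoC1|].
(* At [t = 0] the coupling map is the identity, so [Q] is the identity and the term with [K] in the
   operator has factor 0. *)
have t0 : 0 \in `]- e3, e3[ by rewrite in_itv/= oppr_lt0 e3_gt0.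
have := main 0 t0; rewrite /= K0.
have -> // : (fun g : R -> R => g - transfer F (Q h 0 (rho 0) g) +
    0 *: transfer F (K h 0 (rho 0) g)) = fun g => g - transfer F g.
by apply/funext => g; rewrite Q0 scale0r addr0.
Qed.
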